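(* Let $G=\langle s_1,\ldots,s_r\rangle$ be a free group on $r$ generators. Let $T$ be a measure-preserving action of $G$ on a standard probability space and let $S$ be a factor of $T$. Assume there exist finite generating partitions for $T$ and $S$. Let $\alpha$ be a finite generating partition for $T$. Then $$f(S)\ge f(T)-H(\alpha).$$
   Context: A measure-preserving action $T=(T_g)_{g\in G}$ of $G$ on a standard probability space $(X,\mu)$ consists of measure-preserving maps $T_g:X\to X$ with $T_{g_1}T_{g_2}=T_{g_1g_2}$. An action $S$ of $G$ on a standard probability space $(Y,\nu)$ is a factor of $T$ if there is a measurable map $\phi:X\to Y$ with $\phi_*\mu=\nu$ and $\phi(T_gx)=S_g\phi(x)$ for all $g\in G$ and a.e. $x\in X$. A countable measurable partition $\alpha$ is generating if the smallest $G$-invariant $\sigma$-algebra containing $\alpha$ equals the $\sigma$-algebra of all measurable sets up to sets of measure zero. $H(\alpha)=-\sum_{P\in\alpha}\mu(P)\log\mu(P)$ (with $0\log0=0$), and $\alpha\vee\beta=\{P\cap Q: P\in\alpha,Q\in\beta\}$. Let $B(e,n)$ be the ball of radius $n$ around the identity $e$ in $G$ for the word metric of $\{s_1^{\pm1},\ldots,s_r^{\pm1}\}$. Define $$F(T,\alpha)=(1-2r)H(\alpha)+\sum_{i=1}^rH(\alpha\vee T_{s_i}^{-1}\alpha),\qquad \alpha^n=\bigvee_{g\in B(e,n)}T_g^{-1}\alpha,\qquad f(T,\alpha)=\inf_nF(T,\alpha^n).$$ The $f$-invariant of the action is $f(T):=f(T,\alpha)$, where $\alpha$ is any generating partition with $H(\alpha)<\infty$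 (if one exists); by a previously known theorem of Bowen the value does not depend on the choice of such $\alpha$. *)

(* Defs.v *)
From HB Require Import structures.
From mathcomp Require Import all_boot all_order all_algebra.
From mathcomp Require Import all_classical all_reals all_analysis.
Set Implicit Arguments.
Unset Strict Implicit.
Unset Printing Implicit Defensive.
Import Order.TTheory GRing.Theory Num.Theory.

Local Open Scope classical_set_scope.
Local Open Scope ring_scope.

Section FreeGroup.
Context {r : nat} {G : groupType}.

(* (i, false) stands for s_i and (i, true) for s_i^-1. *)
Definition letter : Type := ('I_r * bool)%type.

Definition letter_val (s : 'I_r -> G) (a : letter) : G :=
  if a.2 then ((s a.1)^-1)%g else s a.1.

Definition word_val (s : 'I_r -> G) (w : seq letter) : G :=
  (\big[*%g/1]_(a <- w) letter_val s a)%g.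

Definition cancelling (a b : letter) : bool := (a.1 == b.1) && (a.2 != b.2).

Definition reduced (w : seq letter) : bool :=
  sorted (fun a b => ~~ cancelling a b) w.

Definition free_generators (s : 'I_r -> G) : Prop :=
  forall g : G, exists! w : seq letter, reduced w /\ word_val s w = g.

Definition word_ball (s : 'I_r -> G) (n : nat) : set G :=
  [set g | exists w : seq letter, (size w <= n)%N /\ word_val s w = g].

End FreeGroup.

Section Actions.
Context {R : realType}.

(* Mod 0, f is an isomorphism of X onto R with a Borel probability: on a conull
   set X0 it is injective, and it sends measurable sets to sets that are
   measurable for the completed law of f.  Both standard Borel spaces and their
   completions (Lebesgue-Rokhlin spaces) satisfy this. *)
Definition standard_probability d (X : measurableType d)
    (mu : probability X R) : Prop :=
  exists (X0 : set X) (f : X -> R),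
    [/\ measurable X0 /\ mu X0 = 1%E,
        measurable_fun [set: X] f,
        (forall x y, X0 x -> X0 y -> f x = f y -> x = y) &
        forall A : set X, measurable A -> A `<=` X0 ->
          exists B1 B2 : set R,
            [/\ measurable B1, measurable B2, B1 `<=` f @` A, f @` A `<=` B2 &
                mu (f @^-1` (B2 `\` B1)) = 0%E]].

Definition measure_preserving d d' (X : measurableType d)
    (Y : measurableType d') (mu : probability X R) (nu : probability Y R)
    (f : X -> Y) : Prop :=
  measurable_fun [set: X] f /\
  forall A : set Y, measurable A -> mu (f @^-1` A) = nu A.

(* T 1 = id is not imposed: as T 1 is idempotent and measure-preserving, every
   measurable set agrees with its T 1-preimage up to a null set. *)
Definition mp_action (G : groupType) d (X : measurableType d)
    (mu : probability X R) (T : G -> X -> X) : Prop :=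
  (forall g, measure_preserving mu mu (T g)) /\
  (forall g h x, T g (T h x) = T (g * h)%g x).

Definition is_factor (G : groupType) d d' (X : measurableType d)
    (Y : measurableType d') (mu : probability X R) (T : G -> X -> X)
    (nu : probability Y R) (S : G -> Y -> Y) : Prop :=
  exists phi : X -> Y,
    measure_preserving mu nu phi /\
    forall g, {ae mu, forall x, phi (T g x) = S g (phi x)}.

(* A partition is the set of its pieces; set0 is allowed as a piece, so that
   joins as defined below are again partitions. *)
Definition countable_partition d (X : measurableType d)
    (alpha : set (set X)) : Prop :=
  [/\ countable alpha, alpha `<=` measurable,
      trivIset alpha id & \bigcup_(P in alpha) P = [set: X]].

Definition partition_join (X : Type) (alpha beta : set (set X)) : set (set X) :=
  [set P `&` Q | P in alpha & Q in beta].

Definition bigjoin (I X : Type) (D : set I) (alpha : I -> set (set X)) :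
    set (set X) :=
  [set A | exists c : I -> set X,
     (forall i, D i -> alpha i (c i)) /\ A = \bigcap_(i in D) c i].

Definition partition_preim (X : Type) (t : X -> X) (alpha : set (set X)) :
    set (set X) :=
  [set t @^-1` P | P in alpha].

Definition invariant_sigma_algebra (G X : Type) (T : G -> X -> X)
    (M : set (set X)) : Prop :=
  sigma_algebra [set: X] M /\ forall g A, M A -> M (T g @^-1` A).

Definition generating (G : Type) d (X : measurableType d)
    (mu : probability X R) (T : G -> X -> X) (alpha : set (set X)) : Prop :=
  countable_partition alpha /\
  forall A : set X, measurable A ->
    exists2 B, smallest (invariant_sigma_algebra T) alpha B &
               mu (A `+` B) = 0%E.

(* ln 0 = 0; the terms are nonnegative, so the sum over the pieces makes sense
   in [0, +oo]. *)
Definition entropy d (X : measurableType d) (mu : probability X R)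
    (alpha : set (set X)) : \bar R :=
  \esum_(P in alpha) (- (fine (mu P) * ln (fine (mu P))))%:E.

Definition F_functional (r : nat) (G : groupType) (s : 'I_r -> G) d
    (X : measurableType d) (mu : probability X R) (T : G -> X -> X)
    (alpha : set (set X)) : \bar R :=
  ((1 - 2 * r%:R)%:E * entropy mu alpha +
   \sum_(i < r)
     entropy mu (partition_join alpha (partition_preim (T (s i)) alpha)))%E.

Definition ball_join (r : nat) (G : groupType) (s : 'I_r -> G) (X : Type)
    (T : G -> X -> X) (alpha : set (set X)) (n : nat) : set (set X) :=
  bigjoin (word_ball s n) (fun g => partition_preim (T g) alpha).

Definition f_partition (r : nat) (G : groupType) (s : 'I_r -> G) d
    (X : measurableType d) (mu : probability X R) (T : G -> X -> X)
    (alpha : set (set X)) : \bar R :=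
  ereal_inf (range (fun n => F_functional s mu T (ball_join s T alpha n))).

(* The value at an arbitrary generating partition of finite entropy; by Bowen's
   theorem it does not depend on the partition.  If there is no such partition
   the value is the dummy 0. *)
Definition f_invariant (r : nat) (G : groupType) (s : 'I_r -> G) d
    (X : measurableType d) (mu : probability X R) (T : G -> X -> X) : \bar R :=
  xget 0%E [set v | exists alpha : set (set X),
    [/\ generating mu T alpha, (entropy mu alpha < +oo)%E &
        v = f_partition s mu T alpha]].

End Actions.

(* Main.v *)
Require Import Defs.
From mathcomp Require Import all_boot all_order all_algebra.
From mathcomp Require Import all_classical all_reals all_analysis.
From mathcomp Require Import ring lra.
Set Implicit Arguments.
Unset Strict Implicit.
Unset Printing Implicit Defensive.
Import Order.TTheory GRing.Theory Num.Theory.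
Import numFieldNormedType.Exports.

(** The inequality reduces to the invariance of [f_partition] under a change of
    generator, through one estimate.  For partitions [k] and [b],
      F (k v b) <= F k + H (b | k),
    since each entropy in the sum defining [F] grows by at most [2 H (b | k)]
    while [(1 - 2r) H] changes by [(1 - 2r) H (b | k)].  Take for [k] the
    pullback [gamma^n] of a ball join of a generator [gamma] of the factor, and
    [b := alpha].  The join is a generator of [T], hence
      f (T) <= F (gamma^n v alpha) <= F (gamma^n) + H (alpha),
    where [F (gamma^n)] may be computed in the factor.  The infimum over [n] is
    the claim.

    The first inequality is Bowen's theorem: a generator [b] and a generator
    [a], both of finite entropy, satisfy [inf_n F (b^n) <= F a].  Its first
    ingredient is that [F] decreases along splittings ([F_obs_splitting]): if
    [z] refines [b], then joining to [z] a translate of [b] by a letter costs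
    [(2r - 1) D] in the sum, [D] being the entropy gained, and [(1 - 2r) D] is
    what the first term gives back; the sum costs only [2r - 1] because in the
    direction of the letter one of the two new translates is already present.
    Iterating over balls gives [F (b^n) <= F z] whenever [b <= z <= b^n]
    ([F_obs_orbit_join_le]).  The second ingredient is approximation
    ([approximate_observable]): since [b] generates, every [a] of finite entropy
    is close, in both conditional entropies, to some [a'] coarser than a ball
    join of [b].  Now choose [m] such that [H (b | a^m)] is small, and then [a']
    so close to [a] that [H (b | a'^m)] is small as well.  With
    [z := a'^m v b], which lies between [b] and a ball join of [b],
      F (b^n) <= F z <= F (a'^m) + H (b | a'^m) <= F a' + small <= F a + small
    ([F_obs_orbit_join_generating]).

    Entropy is handled through labellings [X -> K] with [K] countable: joins
    become pairs, joins over a finite set of group elements become sequences,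
    and a partition enters only through the fibres of a labelling ([codes]).
    Besides a continuity estimate ([shannon_fano]), all the inequalities between
    entropies follow from monotonicity under refinement modulo null sets
    ([shannon_refines]) and submodularity ([shannon_submodular]). *)

Local Open Scope classical_set_scope.
Local Open Scope ring_scope.

(** * Unconditional sums *)

Section EsumComplements.
Context {R : realType}.

Lemma esumZ (T : choiceType) (c : R) (a : T -> \bar R) :
  0 <= c -> (forall t, (0 <= a t)%E) ->
  (\esum_(t in [set: T]) (c%:E * a t) = c%:E * \esum_(t in [set: T]) a t)%E.
Proof.
move=> c0 a0.
have le_scale (e : R) (b : T -> \bar R) : 0 <= e -> (forall t, (0 <= b t)%E) ->
    (\esum_(t in [set: T]) (e%:E * b t) <= e%:E * \esum_(t in [set: T]) b t)%E.
  move=> e0 b0; apply: ge_ereal_sup => _ [A [finA _] <-].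
  rewrite -ge0_mule_fsumr//; apply: lee_wpmul2l; first by rewrite lee_fin.
  by apply: esum_ge; exists A.
apply/eqP; rewrite eq_le le_scale//=.
have [->|cn0] := eqVneq c 0.
  by rewrite mul0e esum_ge0// => t _; rewrite mul0e.
have cp : 0 < c by rewrite lt_neqAle eq_sym cn0.
have -> : (\esum_(t in [set: T]) a t =
    \esum_(t in [set: T]) (c^-1%:E * (c%:E * a t)))%E.
  by apply: eq_esum => t _; rewrite muleA -EFinM mulVf// mul1e.
rewrite -[leRHS]mul1e -[in leRHS](mulfV cn0) EFinM -muleA.
apply: lee_wpmul2l; first by rewrite lee_fin.
by apply: le_scale => [|t]; rewrite ?invr_ge0// mule_ge0 ?lee_fin.
Qed.

Lemma esum_pair (T U : choiceType) (f : T * U -> \bar R) :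
  (forall p, (0 <= f p)%E) ->
  (\esum_(p in [set: T * U]) f p =
   \esum_(t in [set: T]) \esum_(u in [set: U]) f (t, u))%E.
Proof.
move=> f0; rewrite (esum_esum (a := fun t u => f (t, u)))//.
rewrite (_ : _ `*`` _ = setT); last by apply/seteqP; split.
by apply: eq_esum => -[].
Qed.

Lemma exchange_esum (T U : choiceType) (f : T -> U -> \bar R) :
  (forall t u, (0 <= f t u)%E) ->
  (\esum_(t in [set: T]) \esum_(u in [set: U]) f t u =
   \esum_(u in [set: U]) \esum_(t in [set: T]) f t u)%E.
Proof.
move=> f0; rewrite -(esum_pair (f := fun p => f p.1 p.2))//.
rewrite -(esum_pair (f := fun p => f p.2 p.1))//.
rewrite (reindex_esum setT setT (fun p : U * T => (p.2, p.1)))//.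
by split=> // [[? ?] [? ?] _ _ [-> ->]//|[t u] _]; exists (u, t).
Qed.

End EsumComplements.

(** * Shannon entropy of countable labellings *)

Section Labellings.
Context {R : realType} {d : measure_display} {X : measurableType d}.
Variable mu : probability X R.

Definition measurable_label (K : countType) (a : X -> K) : Prop :=
  forall k, measurable (a @^-1` [set k]).

Definition mass (K : countType) (a : X -> K) (k : K) : R :=
  fine (mu (a @^-1` [set k])).

Definition shannon (K : countType) (a : X -> K) : \bar R :=
  \esum_(k in [set: K]) (- (mass a k * ln (mass a k)))%:E.

(** [b] is a function of [a] off a null set.  The pairwise form avoids
    exhibiting that function, so that joins and pullbacks preserve refinement
    without any choice. *)
Definition refines (K L : countType) (a : X -> K) (b : X -> L) : Prop :=
  exists2 N, mu.-negligible N &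
    forall x y, ~ N x -> ~ N y -> a x = a y -> b x = b y.

Definition pair_label (K L : countType) (a : X -> K) (b : X -> L) (x : X) :
  K * L := (a x, b x).

Lemma measurable_label_preimage (K : countType) (a : X -> K) (E : set K) :
  measurable_label a -> measurable (a @^-1` E).
Proof.
move=> ma; rewrite (_ : _ @^-1` _ = \bigcup_(k in E) a @^-1` [set k]).
  rewrite bigcup_mkcond; apply: countable_bigcupT_measurable => [|k].
    exact: countableP.
  by case: ifP => // _; exact: ma.
by apply/seteqP; split=> [x Ex|x [k Ek]]; [exists (a x)|move=> /= ->].
Qed.

Lemma measurable_label_comp (K L : countType) (a : X -> K) (h : K -> L) :
  measurable_label a -> measurable_label (h \o a).
Proof.
by move=> ma l; rewrite comp_preimage; exact: measurable_label_preimage.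
Qed.

Lemma pair_label_preimage (K L : countType) (a : X -> K) (b : X -> L) k l :
  pair_label a b @^-1` [set (k, l)] = a @^-1` [set k] `&` b @^-1` [set l].
Proof. by apply/seteqP; split=> x /=; [case|case=> <- <-]. Qed.

Lemma measurable_pair_label (K L : countType) (a : X -> K) (b : X -> L) :
  measurable_label a -> measurable_label b -> measurable_label (pair_label a b).
Proof.
by move=> ma mb [k l]; rewrite pair_label_preimage; exact: measurableI.
Qed.

Lemma mass_ge0 (K : countType) (a : X -> K) k : 0 <= mass a k.
Proof. exact: fine_ge0. Qed.

Lemma massE (K : countType) (a : X -> K) k : measurable_label a ->
  (mass a k)%:E = mu (a @^-1` [set k]).
Proof. by move=> ma; rewrite /mass fineK// fin_num_measure. Qed.

Lemma mass_le1 (K : countType) (a : X -> K) k : measurable_label a ->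
  mass a k <= 1.
Proof. by move=> ma; rewrite -lee_fin massE// probability_le1. Qed.

Lemma eta_ge0 (x : R) : 0 <= x <= 1 -> 0 <= - (x * ln x).
Proof.
by move=> /andP[x0 x1]; rewrite -mulrN mulr_ge0// oppr_ge0 ln_le0.
Qed.

Lemma mass_eta_ge0 (K : countType) (a : X -> K) k : measurable_label a ->
  0 <= - (mass a k * ln (mass a k)).
Proof. by move=> ma; rewrite eta_ge0// mass_ge0 mass_le1. Qed.

Lemma lnmass_ge0 (K : countType) (a : X -> K) k : measurable_label a ->
  0 <= - ln (mass a k).
Proof. by move=> ma; rewrite oppr_ge0 ln_le0// mass_le1. Qed.

(** The alphabet is enumerated by [pickle], which turns the unconditional sum
    into the series of sigma-additivity; codes outside the range of [pickle]
    have empty fibres. *)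
Lemma esum_fibers (K : countType) (a : X -> K) (B : set X) :
  measurable_label a -> measurable B ->
  (\esum_(k in [set: K]) mu (B `&` a @^-1` [set k]) = mu B)%E.
Proof.
move=> ma mB; pose F n := B `&` (pickle \o a) @^-1` [set n].
have mF n : measurable (F n).
  by apply: measurableI => //; apply: measurable_label_comp.
have UF : \bigcup_n F n = B.
  apply/seteqP; split=> [x [n _ []]//|x Bx]; by exists (pickle (a x)).
have tF : trivIset setT F.
  by move=> i j _ _ [x [[_ /= <-] [_ /= <-]]].
have e : mu B = (\esum_(n in [set: nat]) mu (F n))%E.
  by rewrite -[in LHS]UF measure_bigcup// nneseries_esum// set_mem_set.
rewrite e (esumID (range (pickle : K -> nat)))//.
rewrite [X in (_ + X)%E]esum1 ?adde0; last first.
  move=> n [_ /= nr]; rewrite (_ : F n = set0) ?measure0//.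
  by rewrite -subset0 => x [_ /= xn]; apply: nr; exists (a x).
rewrite setTI esum_image; last by move=> ? ? _ _ /(pcan_inj (@pickleK K)).
apply: eq_esum => k _; congr (mu (_ `&` _)); apply/seteqP; split=> x /=.
  by move=> ->.
exact: (pcan_inj (@pickleK K)).
Qed.

Lemma esum_mass (K : countType) (a : X -> K) : measurable_label a ->
  (\esum_(k in [set: K]) (mass a k)%:E = 1)%E.
Proof.
move=> ma; rewrite -(@probability_setT _ _ _ mu) -(esum_fibers ma measurableT).
by apply: eq_esum => k _; rewrite massE// setTI.
Qed.

Lemma esum_mass_pairr (K L : countType) (a : X -> K) (b : X -> L) k (c : R) :
  measurable_label a -> measurable_label b -> 0 <= c ->
  (\esum_(l in [set: L]) (mass (pair_label a b) (k, l) * c)%:E =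
   (mass a k * c)%:E)%E.
Proof.
move=> ma mb c0; rewrite mulrC EFinM massE// -(esum_fibers mb (ma k)) -esumZ//.
apply: eq_esum => l _; rewrite mulrC EFinM massE ?pair_label_preimage//.
exact: measurable_pair_label.
Qed.

Lemma mass_pairC (K L : countType) (a : X -> K) (b : X -> L) k l :
  mass (pair_label a b) (k, l) = mass (pair_label b a) (l, k).
Proof. by rewrite /mass !pair_label_preimage setIC. Qed.

Lemma esum_mass_pairl (K L : countType) (a : X -> K) (b : X -> L) l (c : R) :
  measurable_label a -> measurable_label b -> 0 <= c ->
  (\esum_(k in [set: K]) (mass (pair_label a b) (k, l) * c)%:E =
   (mass b l * c)%:E)%E.
Proof.
move=> ma mb c0; rewrite -(esum_mass_pairr _ mb ma c0).
by apply: eq_esum => k _; rewrite mass_pairC.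
Qed.

Lemma mass_pair_lel (K L : countType) (a : X -> K) (b : X -> L) p :
  measurable_label a -> measurable_label b ->
  mass (pair_label a b) p <= mass a p.1.
Proof.
move=> ma mb; case: p => k l; rewrite -lee_fin !massE//; last first.
  exact: measurable_pair_label.
rewrite pair_label_preimage le_measure// ?inE//.
exact: measurableI.
Qed.

(** Both sides are the expectation of [phi (h (a x))].  They are expanded over
    the joint law of [a] and [h \o a], which is carried by the graph of [h]. *)
Lemma esum_mass_comp (K L : countType) (a : X -> K) (h : K -> L)
    (phi : L -> R) :
  measurable_label a -> (forall l, 0 <= phi l) ->
  (\esum_(k in [set: K]) (mass a k * phi (h k))%:E =
   \esum_(l in [set: L]) (mass (h \o a) l * phi l)%:E)%E.
Proof.
move=> ma phi0; have mb := measurable_label_comp h ma.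
under eq_esum do rewrite -(esum_mass_pairr _ ma mb)//.
under [RHS]eq_esum do rewrite -(esum_mass_pairl _ ma mb)//.
rewrite [RHS]exchange_esum => [|l k]; last by rewrite lee_fin mulr_ge0 ?mass_ge0.
apply: eq_esum => k _; apply: eq_esum => l _.
have [<-//|hkl] := eqVneq (h k) l.
suff -> : mass (pair_label a (h \o a)) (k, l) = 0 by rewrite !mul0r.
rewrite /mass pair_label_preimage (_ : _ `&` _ = set0) ?measure0//.
by rewrite -subset0 => x [/= -> /eqP]; rewrite (negPf hkl).
Qed.

(** Expand both entropies over the joint law [w] of the two labels.  Where
    [w (k, l) > 0], almost all of the fibre of [k] lies in that of [l], so the
    logarithms compare term by term. *)
Lemma shannon_refines (K L : countType) (a : X -> K) (b : X -> L) :
  measurable_label a -> measurable_label b -> refines a b ->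
  (shannon b <= shannon a)%E.
Proof.
move=> ma mb [N /negligibleS negN ab].
pose w := mass (pair_label a b).
have w0 p : 0 <= w p by exact: mass_ge0.
have wab k l : 0 < w (k, l) -> mass a k <= mass b l.
  move=> wkl; have [Z [mZ Z0 NZ]] : mu.-negligible N by exact: negN.
  have [x [[akx blx] nZx]] : exists x,
      (a @^-1` [set k] `&` b @^-1` [set l] `\` Z) x.
    apply: contrapT => /forallNP noX; move: wkl.
    rewrite /w /mass pair_label_preimage.
    rewrite (_ : mu _ = 0%E) ?ltxx//; apply: (subset_measure0 _ _ _ Z0) => //.
      exact: measurableI.
    by move=> x abx; apply: contrapT => nZx; exact: (noX x).
  rewrite -lee_fin !massE// -(measureU0 (mb l) mZ Z0).
  apply: le_measure; rewrite ?inE//; first exact: measurableU.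
  move=> y /= ay; case: (pselect (Z y)) => [|nZy]; [by right|left].
  rewrite -blx; apply: ab; rewrite ?ay ?akx// => Nz.
    by apply: nZy; exact: NZ.
  by apply: nZx; exact: NZ.
have lnb l : 0 <= - ln (mass b l) by exact: lnmass_ge0.
have lna k : 0 <= - ln (mass a k) by exact: lnmass_ge0.
rewrite /shannon; under eq_esum do rewrite -mulrN -(esum_mass_pairl _ ma mb)//.
under [leRHS]eq_esum do rewrite -mulrN -(esum_mass_pairr _ ma mb)//.
rewrite [leRHS]exchange_esum => [|k l]; last by rewrite lee_fin mulr_ge0.
apply: le_esum => l _; apply: le_esum => k _; rewrite lee_fin -/w.
have [->|wn0] := eqVneq (w (k, l)) 0; first by rewrite !mul0r.
have wp : 0 < w (k, l) by rewrite lt_neqAle eq_sym wn0 w0.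
have ap : 0 < mass a k by exact: lt_le_trans wp (mass_pair_lel (k, l) ma mb).
have bp : 0 < mass b l by exact: lt_le_trans ap (wab _ _ wp).
by rewrite ler_wpM2l// lerN2 ler_ln ?posrE// wab.
Qed.

(** This is [H (a | b, c) <= H (a | c)].  Over the joint law [w] of the three
    labels, with [u], [v], [z] the laws of [(a, c)], [(b, c)] and [c], the
    concavity bound [ln t <= t - 1] at [t = u v / (z w)] gives a termwise
    inequality whose error [q - w] has nonpositive sum.  The term [w] is moved
    to the left-hand side so that all the sums have nonnegative terms and no
    finiteness of the entropies has to be assumed. *)
Lemma shannon_submodular (A B C : countType) (a : X -> A) (b : X -> B)
    (c : X -> C) :
  measurable_label a -> measurable_label b -> measurable_label c ->
  (shannon (pair_label (pair_label a b) c) + shannon c <=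
   shannon (pair_label a c) + shannon (pair_label b c))%E.
Proof.
move=> ma mb mc; set t := pair_label (pair_label a b) c.
have mac : measurable_label (pair_label a c) by exact: measurable_pair_label.
have mbc : measurable_label (pair_label b c) by exact: measurable_pair_label.
have mt : measurable_label t by do 2?apply: measurable_pair_label.
pose w := mass t; pose u := mass (pair_label a c).
pose v := mass (pair_label b c); pose z := mass c.
have expand (L : countType) (l : X -> L) (h : A * B * C -> L) : l = h \o t ->
    shannon l = (\esum_(p in [set: A * B * C]) (w p * - ln (mass l (h p)))%:E)%E.
  move=> lht; have ml : measurable_label l.
    by rewrite lht; exact: measurable_label_comp.
  have lnl k : 0 <= - ln (mass l k) by exact: lnmass_ge0.
  rewrite (esum_mass_comp h mt lnl) -lht.
  by apply: eq_esum => k _; rewrite mulrN.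
rewrite (expand _ t id)// (expand _ c (fun p => p.2))//.
rewrite (expand _ (pair_label a c) (fun p => (p.1.1, p.2)))//.
rewrite (expand _ (pair_label b c) (fun p => (p.1.2, p.2)))//.
rewrite -/w -/u -/v -/z.
(* the law making [a] and [b] independent conditionally on [c] *)
pose q (p : A * B * C) := u (p.1.1, p.2) * v (p.1.2, p.2) / z p.2.
have w0 p : 0 <= w p by exact: mass_ge0.
have u0 p : 0 <= u p by exact: mass_ge0.
have v0 p : 0 <= v p by exact: mass_ge0.
have z0 p : 0 <= z p by exact: mass_ge0.
have q0 p : 0 <= q p by rewrite divr_ge0// mulr_ge0.
have q_le1 : (\esum_(p in [set: A * B * C]) (q p)%:E <= 1)%E.
  rewrite -(esum_mass mc) esum_pair//.
  rewrite exchange_esum => [|p k]; last by rewrite lee_fin.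
  apply: le_esum => k _; rewrite /q/= esum_pair/=; last first.
    by move=> p; rewrite lee_fin divr_ge0// mulr_ge0.
  have zk0 : 0 <= (z k)^-1 by rewrite invr_ge0.
  under eq_esum => i _.
    under eq_esum do rewrite -mulrA mulrCA.
    rewrite esum_mass_pairl ?mulr_ge0 -/z//. rewrite mulrCA. over.
  rewrite esum_mass_pairl ?mulr_ge0// -/z lee_fin.
  have [->|zkn0] := eqVneq (z k) 0; first by rewrite mul0r.
  by rewrite mulfV// mulr1.
have lnw0 p : 0 <= w p * - ln (w p) by rewrite mulr_ge0// lnmass_ge0.
have lnu0 p : 0 <= w p * - ln (u (p.1.1, p.2)) by rewrite mulr_ge0// lnmass_ge0.
have lnv0 p : 0 <= w p * - ln (v (p.1.2, p.2)) by rewrite mulr_ge0// lnmass_ge0.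
have lnz0 p : 0 <= w p * - ln (z p.2) by rewrite mulr_ge0// lnmass_ge0.
rewrite -!esumD; try by move=> i _; rewrite lee_fin.
rewrite -(@leeD2rE _ 1%E)// -[in leLHS](esum_mass mt).
apply: (@le_trans _ _ (\esum_(p in [set: A * B * C])
   ((w p * - ln (u (p.1.1, p.2)))%:E + (w p * - ln (v (p.1.2, p.2)))%:E
    + (q p)%:E))%E); last first.
  rewrite [leLHS]esumD; first exact: leeD2l.
    by move=> p _; rewrite -EFinD lee_fin addr_ge0.
  by move=> p _; rewrite lee_fin.
rewrite -esumD; try by move=> i _; rewrite -?EFinD lee_fin ?addr_ge0 ?mass_ge0.
rewrite -/w; apply: le_esum => -[[i j] k] _; rewrite -!EFinD lee_fin /q/=.
have [->|wn0] := eqVneq (w (i, j, k)) 0.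
  by rewrite !mul0r !add0r divr_ge0// mulr_ge0.
have wp : 0 < w (i, j, k) by rewrite lt_neqAle eq_sym wn0 w0.
have le_mass (L : countType) (l : X -> L) (h : A * B * C -> L) : l = h \o t ->
    0 < mass l (h (i, j, k)).
  move=> lht; have ml : measurable_label l.
    by rewrite lht; exact: measurable_label_comp.
  apply: (lt_le_trans wp); rewrite -lee_fin !massE//.
  by apply: le_measure; rewrite ?inE// => x /= txE; rewrite lht/= txE.
have up : 0 < u (i, k) by exact: (le_mass _ _ (fun p => (p.1.1, p.2))).
have vp : 0 < v (j, k) by exact: (le_mass _ _ (fun p => (p.1.2, p.2))).
have zp : 0 < z k by exact: (le_mass _ _ (fun p => p.2)).
set W := w _ in wp *; set U := u _ in up *; set V := v _ in vp *.
set Z := z _ in zp *.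
have : ln (U * V / Z / W) <= U * V / Z / W - 1.
  rewrite -{1}[U * V / Z / W](subrKC 1) le_ln1Dx// ltrBrDl subrr.
  by rewrite !divr_gt0// mulr_gt0.
rewrite !(lnM, lnV) ?posrE ?invr_gt0 ?mulr_gt0// ?invr_gt0 ?mulr_gt0//.
set Q := U * V / Z => /(ler_wpM2l (ltW wp)).
have -> : W * (Q / W - 1) = Q - W by rewrite mulrBr mulr1 mulrCA mulfV// mulr1.
by rewrite !mulrDr; lra.
Qed.

End Labellings.

(** * Refinement modulo null sets *)

Section Refinement.
Context {R : realType} {d : measure_display} {X : measurableType d}.
Variable mu : probability X R.

Lemma refines_fun (K L : countType) (a : X -> K) (b : X -> L) :
  (forall x y, a x = a y -> b x = b y) -> refines mu a b.
Proof.
by move=> ab; exists set0 => [|x y _ _]; [exact: negligible_set0|exact: ab].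
Qed.

Lemma refines_refl (K : countType) (a : X -> K) : refines mu a a.
Proof. exact: refines_fun. Qed.

Lemma refines_trans (K L M : countType) (b : X -> L) (a : X -> K) (c : X -> M) :
  refines mu a b -> refines mu b c -> refines mu a c.
Proof.
move=> [N nN ab] [N' nN' bc]; exists (N `|` N'); first exact: negligibleU.
by move=> x y /not_orP[Nx N'x] /not_orP[Ny N'y] /ab-/(_ Nx Ny)/bc; exact.
Qed.

Lemma refines_pair (K L M : countType) (a : X -> K) (b : X -> L) (c : X -> M) :
  refines mu a b -> refines mu a c -> refines mu a (pair_label b c).
Proof.
move=> [N nN ab] [N' nN' ac]; exists (N `|` N'); first exact: negligibleU.
move=> x y /not_orP[Nx N'x] /not_orP[Ny N'y] axy.
by rewrite /pair_label (ab x y)// (ac x y).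
Qed.

Lemma refines_fst (K L : countType) (a : X -> K) (b : X -> L) :
  refines mu (pair_label a b) a.
Proof. by apply: refines_fun => x y []. Qed.

Lemma refines_snd (K L : countType) (a : X -> K) (b : X -> L) :
  refines mu (pair_label a b) b.
Proof. by apply: refines_fun => x y []. Qed.

Lemma refines_ae (K L : countType) (a : X -> K) (b b' : X -> L) :
  {ae mu, forall x, b x = b' x} -> refines mu a b -> refines mu a b'.
Proof.
move=> bb' ab; apply: (refines_trans ab).
exists (~` [set x | b x = b' x]) => // x y.
by move=> /contrapT/= <- /contrapT/= <-.
Qed.

Lemma shannon_cst (K : countType) (k : K) : shannon mu (cst k : X -> K) = 0%E.
Proof.
apply: esum1 => l _; rewrite /mass; have [->|kl] := eqVneq k l.
  rewrite (_ : _ @^-1` _ = setT) ?probability_setT ?ln1 ?mulr0 ?oppr0//.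
  exact/seteqP.
rewrite (_ : _ @^-1` _ = set0) ?measure0 ?mul0r ?oppr0//.
by rewrite -subset0 => x /= klx; rewrite klx eqxx in kl.
Qed.

(** Submodularity over the trivial labelling. *)
Lemma shannon_subadditive (K L : countType) (a : X -> K) (b : X -> L) :
  measurable_label a -> measurable_label b ->
  (shannon mu (pair_label a b) <= shannon mu a + shannon mu b)%E.
Proof.
move=> ma mb; have mt : measurable_label (cst tt : X -> unit).
  by move=> k; rewrite preimage_cst; case: ifP.
have drop (M : countType) (c : X -> M) : measurable_label c ->
    shannon mu (pair_label c (cst tt : X -> unit)) = shannon mu c.
  move=> mc; apply/eqP; rewrite eq_le !shannon_refines//;
    try exact: measurable_pair_label.
  - exact: refines_fst.
  - by apply: refines_fun => x y; rewrite /pair_label => ->.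
have := shannon_submodular mu ma mb mt.
by rewrite shannon_cst adde0 !drop//; exact: measurable_pair_label.
Qed.

End Refinement.

(** * Transport along measure-preserving maps *)

Section MeasurePreserving.
Context {R : realType} {d d' : measure_display} {X : measurableType d}
  {Y : measurableType d'} {mu : probability X R} {nu : probability Y R}.
Variables (phi : X -> Y) (mphi : measure_preserving mu nu phi).

Lemma measurable_label_pullback (K : countType) (b : Y -> K) :
  measurable_label b -> measurable_label (b \o phi).
Proof.
by move=> mb k; rewrite comp_preimage -[_ @^-1` _]setTI; apply: mphi.1.
Qed.

Lemma shannon_pullback (K : countType) (b : Y -> K) :
  measurable_label b -> shannon mu (b \o phi) = shannon nu b.
Proof.
move=> mb; apply: eq_esum => k _; rewrite /mass comp_preimage.
by rewrite (mphi.2 _ (mb k)).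
Qed.

Lemma negligible_pullback (N : set Y) :
  nu.-negligible N -> mu.-negligible (phi @^-1` N).
Proof.
move=> [Z [mZ Z0 NZ]]; exists (phi @^-1` Z); split.
- by rewrite -[_ @^-1` _]setTI; apply: mphi.1.
- by rewrite -Z0; exact: mphi.2.
- by move=> x /NZ.
Qed.

Lemma refines_pullback (K L : countType) (a : Y -> K) (b : Y -> L) :
  refines nu a b -> refines mu (a \o phi) (b \o phi).
Proof.
move=> [N nN ab]; exists (phi @^-1` N); first exact: negligible_pullback.
by move=> x y; exact: ab.
Qed.

End MeasurePreserving.

(** * Labellings of finite entropy *)

Section Observables.
Context {R : realType} {d : measure_display} {X : measurableType d}.
Variable mu : probability X R.

(** Bundling finiteness of the entropy makes all the entropies below real
    numbers. *)
Record observable := Observable {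
  alphabet : countType;
  label :> X -> alphabet;
  measurable_observable : measurable_label label;
  finite_shannon : (shannon mu label < +oo)%E }.

Arguments measurable_observable o : clear implicits.

Definition ent (a : observable) : R := fine (shannon mu a).

Lemma shannon_ge0 (K : countType) (a : X -> K) :
  measurable_label a -> (0 <= shannon mu a)%E.
Proof. by move=> ma; apply: esum_ge0 => k _; rewrite lee_fin mass_eta_ge0. Qed.

Lemma entE (a : observable) : (ent a)%:E = shannon mu a.
Proof.
rewrite fineK// ge0_fin_numE ?finite_shannon//.
exact/shannon_ge0/measurable_observable.
Qed.

Lemma finite_shannon_join (a b : observable) :
  (shannon mu (pair_label a b) < +oo)%E.
Proof.
apply: le_lt_trans (shannon_subadditive _ _ _) _;
  try exact: measurable_observable.
by rewrite -!entE -EFinD ltry.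
Qed.

Definition join (a b : observable) : observable :=
  Observable
    (measurable_pair_label (measurable_observable a) (measurable_observable b))
    (finite_shannon_join a b).

Lemma ent_refines (a b : observable) : refines mu a b -> ent b <= ent a.
Proof.
by move=> ab; rewrite -lee_fin !entE shannon_refines//;
  exact: measurable_observable.
Qed.

Lemma ent_eq (a b : observable) : refines mu a b -> refines mu b a ->
  ent a = ent b.
Proof. by move=> ab ba; apply/eqP; rewrite eq_le !ent_refines. Qed.

(** The lattice form of submodularity, for any [c] coarser than [a] and [b]. *)
Lemma ent_submodular (a b c : observable) :
  refines mu a c -> refines mu b c ->
  ent (join a b) + ent c <= ent a + ent b.
Proof.
move=> ac bc.
have := shannon_submodular mu (measurable_observable a)
  (measurable_observable b) (measurable_observable c).
rewrite -(entE (join (join a b) c)) -(entE c).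
rewrite -(entE (join a c)) -(entE (join b c)) -!EFinD lee_fin.
have -> : ent (join (join a b) c) = ent (join a b).
  apply: ent_eq; first exact: refines_fst.
  apply: refines_pair (refines_refl _ _) _.
  exact: refines_trans (refines_fst _ _ _) ac.
have -> : ent (join a c) = ent a.
  apply: ent_eq; first exact: refines_fst.
  exact: refines_pair (refines_refl _ _) ac.
have -> // : ent (join b c) = ent b.
apply: ent_eq; first exact: refines_fst.
exact: refines_pair (refines_refl _ _) bc.
Qed.

Lemma ent_subadditive (a b : observable) : ent (join a b) <= ent a + ent b.
Proof.
rewrite -lee_fin EFinD !entE; apply: shannon_subadditive;
  exact: measurable_observable.
Qed.

Lemma refines_join (a b c : observable) :
  refines mu a b -> refines mu a c -> refines mu a (join b c).
Proof. exact: refines_pair. Qed.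

Lemma refines_joinl (a b c : observable) :
  refines mu a c -> refines mu (join a b) c.
Proof. exact/refines_trans/refines_fst. Qed.

Lemma refines_joinr (a b c : observable) :
  refines mu b c -> refines mu (join a b) c.
Proof. exact/refines_trans/refines_snd. Qed.

Lemma coarsening_subproof (a : observable) (K : countType) (h : alphabet a -> K) :
  (shannon mu (h \o a) < +oo)%E.
Proof.
have ma := measurable_observable a.
apply: le_lt_trans (finite_shannon a); apply: shannon_refines => //.
  exact: measurable_label_comp.
by apply: refines_fun => x y /= ->.
Qed.

Definition coarsening (a : observable) (K : countType) (h : alphabet a -> K) :=
  Observable (measurable_label_comp h (measurable_observable a))
    (coarsening_subproof h).

Definition cond_ent (a b : observable) : R := ent (join a b) - ent b.

Lemma cond_ent_ge0 a b : 0 <= cond_ent a b.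
Proof. by rewrite subr_ge0; exact/ent_refines/refines_snd. Qed.

Lemma cond_ent_le_ent a b : cond_ent a b <= ent a.
Proof. by rewrite /cond_ent lerBlDr ent_subadditive. Qed.

(** Submodularity for the pair [a v c] and [b], both finer than [c]. *)
Lemma cond_ent_antitone (a b c : observable) : refines mu b c ->
  cond_ent a b <= cond_ent a c.
Proof.
move=> bc; have := @ent_submodular (join a c) b c.
have -> : ent (join (join a c) b) = ent (join a b).
  apply: ent_eq; apply: refines_join.
  - exact/refines_joinl/refines_fst.
  - exact/refines_snd.
  - apply: refines_join; first exact: refines_fst.
    exact: refines_joinr.
  - exact: refines_snd.
by move=> /(_ (refines_snd _ _ _) bc); rewrite /cond_ent; lra.
Qed.

Lemma cond_ent_monotone (a b c : observable) : refines mu a b ->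
  cond_ent b c <= cond_ent a c.
Proof.
move=> ab; rewrite lerB//; apply/ent_refines/refines_join.
  exact: refines_joinl.
exact: refines_snd.
Qed.

Lemma cond_ent_triangle (a b c : observable) :
  cond_ent a c <= cond_ent a b + cond_ent b c.
Proof.
have : cond_ent a (join b c) <= cond_ent a b by exact/cond_ent_antitone/refines_fst.
have : ent (join a c) <= ent (join a (join b c)).
  apply/ent_refines/refines_join; first exact: refines_fst.
  exact/refines_joinr/refines_snd.
by rewrite /cond_ent; lra.
Qed.

Lemma cond_ent_join (a b c : observable) :
  cond_ent (join a b) c <= cond_ent a c + cond_ent b c.
Proof.
have := @ent_submodular (join a c) (join b c) c
  (refines_snd _ _ _) (refines_snd _ _ _).
have : ent (join (join a b) c) <= ent (join (join a c) (join b c)).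
  apply/ent_refines/refines_join; [apply: refines_join|].
  - exact/refines_joinl/refines_fst.
  - exact/refines_joinr/refines_fst.
  - exact/refines_joinl/refines_snd.
by rewrite /cond_ent; lra.
Qed.

End Observables.

Arguments measurable_observable {R d X mu} o.

Section Pullback.
Context {R : realType} {d d' : measure_display} {X : measurableType d}
  {Y : measurableType d'} {mu : probability X R} {nu : probability Y R}.
Variables (phi : X -> Y) (mphi : measure_preserving mu nu phi).

Lemma finite_shannon_pullback (b : observable nu) :
  (shannon mu (b \o phi) < +oo)%E.
Proof.
rewrite (shannon_pullback mphi) ?finite_shannon//.
exact: measurable_observable.
Qed.

Definition pullback (b : observable nu) : observable mu :=
  Observable (measurable_label_pullback mphi (measurable_observable b))
    (finite_shannon_pullback b).

Lemma ent_pullback b : ent (pullback b) = ent b.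
Proof.
by rewrite /ent (shannon_pullback mphi)//; exact: measurable_observable.
Qed.

Lemma cond_ent_pullback a b : cond_ent (pullback a) (pullback b) = cond_ent a b.
Proof. by rewrite /cond_ent ent_pullback -(ent_pullback (join a b)). Qed.

End Pullback.

(** * Splittings *)

Section Action.
Context {R : realType} {r : nat} {G : groupType} (s : 'I_r -> G).
Context {d : measure_display} {X : measurableType d} {mu : probability X R}.
Variables (T : G -> X -> X) (hT : mp_action mu T).

Definition shift (g : G) (a : observable mu) : observable mu :=
  pullback (hT.1 g) a.

Lemma ent_shift g a : ent (shift g a) = ent a.
Proof. exact: ent_pullback. Qed.

Lemma refines_shift g (a b : observable mu) :
  refines mu a b -> refines mu (shift g a) (shift g b).
Proof. exact: refines_pullback (hT.1 g) _ _ _ _. Qed.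

(** On the preimage under [T 1] of the disagreement set, [T 1 (T 1 x)] and
    [T 1 x] would have different labels; but [T 1] is idempotent, so this
    preimage is empty. *)
Lemma ae_shift1 (a : observable mu) : {ae mu, forall x, a (T 1%g x) = a x}.
Proof.
have ma := measurable_observable a.
pose b := pair_label (a \o T 1%g) a.
have mb : measurable_label b.
  exact: measurable_pair_label (measurable_label_pullback (hT.1 1%g) ma) ma.
exists (b @^-1` [set p | p.1 <> p.2]); split => //.
  exact: measurable_label_preimage.
rewrite -(hT.1 1%g).2; last exact: measurable_label_preimage.
rewrite (_ : _ @^-1` _ = set0) ?measure0// -subset0 => x /=.
by rewrite hT.2 mulg1.
Qed.

Lemma refines_shift1 (a b : observable mu) :
  refines mu a b -> refines mu a (shift 1%g b).
Proof.
move=> ab; apply: refines_ae ab; have := ae_shift1 b.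
by apply: filterS => x bx; exact/esym.
Qed.

Lemma refines_shiftK (a b : observable mu) g : refines mu a b ->
  refines mu a (shift g (shift g^-1%g b)).
Proof.
move=> ab; apply: refines_trans (refines_shift1 ab) _.
by apply: refines_fun => x y /=; rewrite /= !hT.2 mulVg.
Qed.

(** The quantity [F_functional] of the partition into fibres of [a], as a real
    number. *)
Definition F_obs (a : observable mu) : R :=
  (1 - 2 * r%:R) * ent a + \sum_(i < r) ent (join a (shift (s i) a)).

Lemma F_obs_eq (a b : observable mu) : refines mu a b -> refines mu b a ->
  F_obs a = F_obs b.
Proof.
move=> ab ba; rewrite /F_obs (ent_eq ab ba); congr (_ + _).
apply: eq_bigr => i _; apply: ent_eq; apply: refines_join;
  by [apply: refines_joinl|apply: refines_joinr; exact: refines_shift].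
Qed.

(** Submodularity read as: refining [z] to [q] increases the entropy of anything
    finer than [z] by at most as much as it increases that of [z]. *)
Lemma ent_join_incr (p q z : observable mu) :
  refines mu p z -> refines mu q z ->
  ent (join p q) <= ent p + (ent q - ent z).
Proof. by move=> pz qz; have := ent_submodular pz qz; lra. Qed.

(** Passing from [z] to the finer [w] increases the entropy of the join once for
    [w] itself and once for its translate. *)
Lemma ent_join_shift_incr g (z w : observable mu) : refines mu w z ->
  ent (join w (shift g w)) <=
  ent (join z (shift g z)) + 2 * (ent w - ent z).
Proof.
move=> wz; pose p := join z (shift g z).
have pw : ent (join p w) <= ent p + (ent w - ent z).
  by apply: ent_join_incr => //; exact: refines_fst.
have : ent (join (join p w) (shift g w)) <=
    ent (join p w) + (ent (shift g w) - ent (shift g z)).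
  apply: ent_join_incr; last exact: refines_shift.
  exact/refines_joinl/refines_snd.
have : ent (join w (shift g w)) <= ent (join (join p w) (shift g w)).
  apply/ent_refines/refines_join; last exact: refines_snd.
  exact/refines_joinl/refines_snd.
rewrite !ent_shift -/p; lra.
Qed.

(** If [w] can already be read from [z] and its translate, only the translate of
    [w] contributes. *)
Lemma ent_join_shift_incrl g (z w : observable mu) : refines mu w z ->
  refines mu (join z (shift g z)) w ->
  ent (join w (shift g w)) <=
  ent (join z (shift g z)) + (ent w - ent z).
Proof.
move=> wz pw; pose p := join z (shift g z).
have : ent (join p (shift g w)) <= ent p + (ent (shift g w) - ent (shift g z)).
  apply: ent_join_incr; last exact: refines_shift.
  exact/refines_snd.
have : ent (join w (shift g w)) <= ent (join p (shift g w)).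
  apply/ent_refines/refines_join; last exact: refines_snd.
  exact/refines_joinl.
rewrite !ent_shift -/p; lra.
Qed.

(** The mirror case: the translate of [w] brings nothing new. *)
Lemma ent_join_shift_incrr g (z w : observable mu) : refines mu w z ->
  refines mu (join z (shift g z)) (shift g w) ->
  ent (join w (shift g w)) <=
  ent (join z (shift g z)) + (ent w - ent z).
Proof.
move=> wz pw; pose p := join z (shift g z).
have : ent (join p w) <= ent p + (ent w - ent z).
  by apply: ent_join_incr => //; exact: refines_fst.
have : ent (join w (shift g w)) <= ent (join p w).
  apply/ent_refines/refines_join; first exact: refines_snd.
  exact/refines_joinl.
rewrite -/p; lra.
Qed.

Lemma F_obs_join (k b : observable mu) :
  F_obs (join k b) <= F_obs k + cond_ent b k.
Proof.
have kb : refines mu (join k b) k by exact: refines_fst.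
have -> : cond_ent b k = ent (join k b) - ent k.
  rewrite /cond_ent (@ent_eq _ _ _ _ (join b k) (join k b))//; apply: refines_join;
    by [exact: refines_snd|exact: refines_fst].
have : \sum_(i < r) ent (join (join k b) (shift (s i) (join k b))) <=
    \sum_(i < r) (ent (join k (shift (s i) k)) + 2 * (ent (join k b) - ent k)).
  by apply: ler_sum => i _; exact: ent_join_shift_incr.
rewrite big_split/= sumr_const card_ord -[_ *+ r]mulr_natr /F_obs.
set S1 := \sum_(i < r) _; set S2 := \sum_(i < r) _.
lra.
Qed.

(** With [D] the gain of entropy, the summand of the letter's own generator
    [s j] grows by [D] only and the [r - 1] others by [2 D] each, which is exactly
    compensated by [(1 - 2r) D].  In direction [j], if the letter is [s j], the
    added translate of [b] is already part of the translate of [z]; if it is the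
    inverse of [s j], its own translate is [b] again. *)
Lemma F_obs_splitting (z b : observable mu) (t : letter) : refines mu z b ->
  F_obs (join z (shift (letter_val s t) b)) <= F_obs z.
Proof.
move=> zb; set w := join z _.
have wz : refines mu w z by exact: refines_fst.
case: t @w wz => j e w wz.
have specialj : ent (join w (shift (s j) w)) <=
    ent (join z (shift (s j) z)) + (ent w - ent z).
  rewrite /w /letter_val /=; case: e @w wz => w wz.
    apply: ent_join_shift_incrr => //.
    apply: refines_trans (_ : refines mu _
      (join (shift (s j) z) (shift (s j) (shift (s j)^-1%g b)))) _.
      apply: refines_join; first exact: refines_snd.
      exact/refines_joinl/refines_shiftK.
    exact: refines_fun.
  apply: ent_join_shift_incrl => //.
  apply: refines_join; first exact: refines_fst.
  exact/refines_joinr/refines_shift.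
rewrite /F_obs (bigD1 j)//= [in leRHS](bigD1 j)//=.
have : \sum_(i < r | i != j) ent (join w (shift (s i) w)) <=
    \sum_(i < r | i != j) (ent (join z (shift (s i) z)) + 2 * (ent w - ent z)).
  by apply: ler_sum => i _; exact: ent_join_shift_incr.
rewrite big_split/= sumr_const -[_ *+ _]mulr_natr.
have -> : #|[pred i | i != j]| = r.-1 by rewrite cardC1 card_ord.
have -> : (r.-1)%:R = r%:R - 1 :> R.
  by case: r j {specialj w wz} => [[]//|n] _; rewrite /= -natr1 addrK.
set S1 := \sum_(i < r | _) _; set S2 := \sum_(i < r | _) _.
lra.
Qed.

End Action.

(** * Joins over finite sets of group elements *)

Section Orbits.
Context {R : realType} {r : nat} {G : groupType} (s : 'I_r -> G).
Context {d : measure_display} {X : measurableType d} {mu : probability X R}.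
Variables (T : G -> X -> X) (hT : mp_action mu T).

Definition orbit_label (K : countType) (b : X -> K) (L : seq G) (x : X) :
    seq K :=
  [seq b (T g x) | g <- L].

Lemma measurable_orbit_label (K : countType) (b : X -> K) L :
  measurable_label b -> measurable_label (orbit_label b L).
Proof.
move=> mb; elim: L => [|g L ih].
  by move=> k; rewrite (_ : orbit_label _ _ = cst [::])// preimage_cst; case: ifP.
apply: (measurable_label_comp (fun p => p.1 :: p.2)
  (a := pair_label (b \o T g) (orbit_label b L))).
exact: measurable_pair_label (measurable_label_pullback (hT.1 g) mb) ih.
Qed.

Lemma finite_shannon_orbit (b : observable mu) L :
  (shannon mu (orbit_label b L) < +oo)%E.
Proof.
have mb := measurable_observable b.
elim: L => [|g L ih].
  by rewrite (_ : orbit_label _ _ = cst [::])// shannon_cst ltry.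
have mL := measurable_orbit_label L mb.
pose o := Observable mL ih.
apply: le_lt_trans (finite_shannon (join (shift hT g b) o)).
apply: shannon_refines.
- exact: measurable_observable.
- exact: measurable_orbit_label.
- apply: refines_fun => x y [/= bxy Lxy].
  by rewrite /orbit_label /= bxy; congr cons.
Qed.

Definition orbit_join (b : observable mu) (L : seq G) : observable mu :=
  Observable (measurable_orbit_label L (measurable_observable b))
    (finite_shannon_orbit b L).

Lemma orbit_labelP (K : countType) (b : X -> K) L x y :
  orbit_label b L x = orbit_label b L y <->
  forall g, g \in L -> b (T g x) = b (T g y).
Proof. by split=> [/eq_in_map//|bxy]; apply/eq_in_map. Qed.

Lemma orbit_join_refines (b : observable mu) L g : g \in L ->
  refines mu (orbit_join b L) (shift hT g b).
Proof. by move=> gL; apply: refines_fun => x y /orbit_labelP; exact. Qed.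

Lemma orbit_join_sub (b : observable mu) L L' : {subset L' <= L} ->
  refines mu (orbit_join b L) (orbit_join b L').
Proof.
move=> L'L; apply: refines_fun => x y /orbit_labelP bxy; apply/orbit_labelP.
by move=> g /L'L/bxy.
Qed.

Lemma refines_orbit_join (a b : observable mu) L :
  (forall g, g \in L -> refines mu a (shift hT g b)) ->
  refines mu a (orbit_join b L).
Proof.
elim: L => [_|g L ih ab]; first exact: refines_fun.
apply: refines_trans (_ : refines mu _ (join (shift hT g b) (orbit_join b L))) _.
  apply: refines_join; first by apply: ab; rewrite mem_head.
  by apply: ih => h hL; apply: ab; rewrite inE hL orbT.
apply: refines_fun => x y [/= bxy Lxy].
  by rewrite /orbit_label /= bxy; congr cons.
Qed.

Lemma orbit_join_cat (b a : observable mu) L L' :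
  refines mu a (orbit_join b L) -> refines mu a (orbit_join b L') ->
  refines mu a (orbit_join b (L ++ L')).
Proof.
move=> aL aL'; apply: refines_orbit_join => g; rewrite mem_cat => /orP[] gL.
  exact: refines_trans aL (orbit_join_refines _ gL).
exact: refines_trans aL' (orbit_join_refines _ gL).
Qed.

Definition translate (L : seq G) (t : G) : seq G := [seq (g * t)%g | g <- L].

Lemma orbit_join_translate (b : observable mu) L t x :
  orbit_join b (translate L t) x = shift hT t (orbit_join b L) x.
Proof.
rewrite /= /orbit_label /translate -map_comp; apply: eq_map => g /=.
by rewrite hT.2.
Qed.

Lemma refines_orbit_join_translate (a b : observable mu) L t :
  refines mu a (shift hT t (orbit_join b L)) <->
  refines mu a (orbit_join b (translate L t)).
Proof.
by split; apply: refines_ae; apply: aeW => x; rewrite orbit_join_translate.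
Qed.

(** Right multiplication, because [T g (T t x) = T (g * t) x]. *)
Definition neighbours (L : seq G) (ts : seq letter) : seq G :=
  flatten [seq translate L (letter_val s t) | t <- ts].

(** One splitting per letter; the observable [z] being split stays finer than
    [orbit_join b L] throughout. *)
Lemma F_obs_neighbours (z b : observable mu) L ts :
  refines mu z (orbit_join b L) ->
  F_obs s hT (join z (orbit_join b (neighbours L ts))) <= F_obs s hT z.
Proof.
move=> zL; elim: ts => [|t ts ih].
  rewrite (@F_obs_eq _ _ _ _ _ _ _ _ _ _ z)//; first exact: refines_fst.
  by apply: refines_join (refines_refl _ _) _; exact: refines_fun.
apply: le_trans ih; set w := join z (orbit_join b (neighbours L ts)).
have wL : refines mu w (orbit_join b L) by exact/refines_joinl.
apply: le_trans (F_obs_splitting s hT t wL).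
have nE : neighbours L (t :: ts) = translate L (letter_val s t) ++ neighbours L ts.
  by [].
rewrite le_eqVlt; apply/orP; left; apply/eqP; apply: F_obs_eq.
  apply: refines_join; first apply: refines_join.
  - exact: refines_fst.
  - apply/refines_joinr/orbit_join_sub => g gN.
    by rewrite nE mem_cat gN orbT.
  - apply/refines_joinr/refines_orbit_join_translate/orbit_join_sub => g gN.
    by rewrite nE mem_cat gN.
apply: refines_join; first exact/refines_joinl/refines_fst.
rewrite nE; apply: orbit_join_cat.
  exact/refines_joinr/refines_orbit_join_translate/refines_refl.
exact/refines_joinl/refines_snd.
Qed.

Fixpoint ball_seq (n : nat) : seq G :=
  if n is m.+1 then
    ball_seq m ++ neighbours (ball_seq m) (enum {: 'I_r * bool})
  else [:: 1%g].

Lemma mem_ball_seq n g : reflect (word_ball s n g) (g \in ball_seq n).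
Proof.
apply: (iffP idP).
  elim: n g => [|n ih] g /=.
    by rewrite inE => /eqP->; exists [::]; split=> //; rewrite /word_val big_nil.
  rewrite mem_cat => /orP[/ih[w [wn wg]]|].
    by exists w; split=> //; exact: leq_trans wn _.
  move=> /flatten_mapP[t _ /mapP[h /ih[w [wn wh]] ->]].
  exists (rcons w t); rewrite size_rcons; split=> //.
  by rewrite -wh /word_val big_rcons.
elim: n g => [|n ih] g [w [wn <-]].
  by move: wn; rewrite leqn0 size_eq0 => /eqP->; rewrite /word_val big_nil inE.
rewrite /= mem_cat; case/lastP: w wn => [_|w t].
  by rewrite ih//; exists [::].
rewrite size_rcons ltnS => wn; apply/orP; right.
apply/flatten_mapP; exists t; first by rewrite mem_enum.
apply/mapP; exists (word_val s w); first by apply: ih; exists w.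
by rewrite /word_val big_rcons.
Qed.

Lemma one_in_ball_seq n : 1%g \in ball_seq n.
Proof. by apply/mem_ball_seq; exists [::]; rewrite /word_val big_nil. Qed.

Lemma sub_ball_seq m n : (m <= n)%N -> {subset ball_seq m <= ball_seq n}.
Proof.
move=> mn g /mem_ball_seq[w [wm wg]]; apply/mem_ball_seq.
by exists w; split=> //; exact: leq_trans mn.
Qed.

Lemma ball_seq_cover : free_generators s ->
  forall L : seq G, exists n, {subset L <= ball_seq n}.
Proof.
move=> hG; elim=> [|g L [n Ln]]; first by exists 0%N.
have [w [[_ wg] _]] := hG g.
exists (maxn n (size w)) => h; rewrite inE => /orP[/eqP->|/Ln].
  apply: (@sub_ball_seq (size w)); first exact: leq_maxr.
  by apply/mem_ball_seq; exists w.
by apply: sub_ball_seq; exact: leq_maxl.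
Qed.

(** The ball of radius [n + 1] consists of the ball of radius [n] and its right
    translates by letters, so each step is an instance of [F_obs_neighbours]. *)
Lemma F_obs_ball (z b : observable mu) n : refines mu z b ->
  F_obs s hT (join z (orbit_join b (ball_seq n))) <= F_obs s hT z.
Proof.
move=> zb; elim: n => [|n ih].
  rewrite (@F_obs_eq _ _ _ _ _ _ _ _ _ _ z)//; first exact: refines_fst.
  apply: refines_join (refines_refl _ _) _; apply: refines_orbit_join => g.
  by rewrite inE => /eqP->; exact: refines_shift1.
apply: le_trans ih; set w := join z (orbit_join b (ball_seq n)).
have wn : refines mu w (orbit_join b (ball_seq n)) by exact: refines_snd.
apply: le_trans (F_obs_neighbours (enum {: 'I_r * bool}) wn).
rewrite le_eqVlt; apply/orP; left; apply/eqP; apply: F_obs_eq.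
  apply: refines_join; first apply: refines_join.
  - exact: refines_fst.
  - by apply/refines_joinr/orbit_join_sub => g gN; rewrite /= mem_cat gN.
  - by apply/refines_joinr/orbit_join_sub => g gN; rewrite /= mem_cat gN orbT.
apply: refines_join; first exact/refines_joinl/refines_fst.
apply: orbit_join_cat; first exact/refines_joinl/refines_snd.
exact: refines_snd.
Qed.

Lemma orbit_join_ball_self (b : observable mu) n :
  refines mu (orbit_join b (ball_seq n)) b.
Proof.
apply: refines_trans (orbit_join_refines _ (one_in_ball_seq n)) _.
by apply: refines_ae (refines_refl _ _); exact: (ae_shift1 hT b).
Qed.

(** Joining a ball join of [b] to [z] does not increase [F], and when that ball
    join refines [z] it absorbs it. *)
Lemma F_obs_orbit_join_le (z b : observable mu) n : refines mu z b ->
  refines mu (orbit_join b (ball_seq n)) z ->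
  F_obs s hT (orbit_join b (ball_seq n)) <= F_obs s hT z.
Proof.
move=> zb bz; apply: le_trans (F_obs_ball n zb).
rewrite (@F_obs_eq _ _ _ _ _ _ _ _ _ _ (join z (orbit_join b (ball_seq n))))//.
  exact: refines_join bz (refines_refl _ _).
exact: refines_snd.
Qed.

(** Each translate contributes one copy of [cond_ent a b] by invariance. *)
Lemma cond_ent_orbit_join (a b : observable mu) L :
  cond_ent (orbit_join a L) (orbit_join b L) <= (size L)%:R * cond_ent a b.
Proof.
elim: L => [|g L ih].
  rewrite mul0r /cond_ent (@ent_eq _ _ _ _ (join _ _) (orbit_join b [::])) ?subrr//.
    exact: refines_snd.
  exact: refines_fun.
rewrite /= -natr1 mulrDl mul1r addrC.
have step1 : cond_ent (orbit_join a (g :: L)) (orbit_join b (g :: L)) <=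
    cond_ent (join (shift hT g a) (orbit_join a L)) (orbit_join b (g :: L)).
  apply/cond_ent_monotone/refines_fun => x y [/= axy Lxy].
  by rewrite /orbit_label /= axy; congr cons.
have step2 : cond_ent (shift hT g a) (orbit_join b (g :: L)) <= cond_ent a b.
  rewrite -(cond_ent_pullback (hT.1 g) a b).
  by apply/cond_ent_antitone/orbit_join_refines; rewrite mem_head.
have step3 : cond_ent (orbit_join a L) (orbit_join b (g :: L)) <=
    cond_ent (orbit_join a L) (orbit_join b L).
  by apply/cond_ent_antitone/orbit_join_sub => h hL; rewrite inE hL orbT.
have := cond_ent_join (shift hT g a) (orbit_join a L) (orbit_join b (g :: L)).
lra.
Qed.

(** [F] is Lipschitz for the Rokhlin distance. *)
Lemma F_obs_perturb (a b : observable mu) e :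
  cond_ent a b <= e -> cond_ent b a <= e ->
  F_obs s hT b <= F_obs s hT a + (1 + 4 * r%:R) * e.
Proof.
move=> ab ba.
have Eab : ent (join a b) = ent (join b a).
  by apply: ent_eq; apply: refines_join; (exact: refines_fst || exact: refines_snd).
have e0 : 0 <= e by exact: le_trans (cond_ent_ge0 a b) ab.
have : \sum_(i < r) ent (join b (shift hT (s i) b)) <=
    \sum_(i < r) (ent (join a (shift hT (s i) a)) + 2 * e).
  apply: ler_sum => i _.
  have w : refines mu (join a b) a by exact: refines_fst.
  have := ent_join_shift_incr hT (s i) w.
  have : ent (join b (shift hT (s i) b)) <=
      ent (join (join a b) (shift hT (s i) (join a b))).
    apply/ent_refines/refines_join; first exact/refines_joinl/refines_snd.
    exact/refines_joinr/refines_shift/refines_snd.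
  move: ba; rewrite /cond_ent Eab; lra.
rewrite big_split/= sumr_const card_ord -[_ *+ r]mulr_natr /F_obs.
set S1 := \sum_(i < r) _; set S2 := \sum_(i < r) _.
have d1 : ent b <= ent a + e.
  have : ent b <= ent (join b a) by exact/ent_refines/refines_fst.
  by move: ba; rewrite /cond_ent; lra.
have d2 : ent a <= ent b + e.
  have : ent a <= ent (join a b) by exact/ent_refines/refines_fst.
  by move: ab; rewrite /cond_ent; lra.
(* the coefficient [1 - 2r] may have either sign, so both bounds on
   [ent b - ent a] are used *)
have r0 : 0 <= r%:R :> R by [].
nra.
Qed.

End Orbits.

(** * Approximation by sets depending on finitely many translates *)

Section Probability.
Context {R : realType} {d : measure_display} {X : measurableType d}.
Variable mu : probability X R.

Definition pr (A : set X) : R := fine (mu A).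

Lemma prE A : measurable A -> (pr A)%:E = mu A.
Proof. by move=> mA; rewrite /pr fineK// fin_num_measure. Qed.

Lemma le_pr A B : measurable A -> measurable B -> A `<=` B -> pr A <= pr B.
Proof. by move=> mA mB AB; rewrite -lee_fin !prE// le_measure ?inE. Qed.

Lemma prU A B : measurable A -> measurable B -> pr (A `|` B) <= pr A + pr B.
Proof.
move=> mA mB; rewrite -lee_fin EFinD !prE//; last exact: measurableU.
exact: measureU2.
Qed.

Lemma pr_bigsetU n (A : nat -> set X) (e : R) :
  (forall i, measurable (A i)) -> (forall i, pr (A i) <= e) ->
  pr (\big[setU/set0]_(i < n) A i) <= n%:R * e.
Proof.
move=> mA Ae; elim: n => [|n ih].
  by rewrite big_ord0 mul0r /pr measure0.
rewrite big_ord_recr/= -natr1 mulrDl mul1r.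
apply: le_trans (prU _ (mA n)) (lerD ih (Ae n)).
by apply: bigsetU_measurable.
Qed.

Lemma measurable_setY (A B : set X) : measurable A -> measurable B ->
  measurable (A `+` B).
Proof. by move=> mA mB; apply: measurableU; exact: measurableD. Qed.

Lemma pr_setY_trans A B C : measurable A -> measurable B -> measurable C ->
  pr (A `+` C) <= pr (A `+` B) + pr (B `+` C).
Proof.
move=> mA mB mC; apply: le_trans (prU _ _); try exact: measurable_setY.
apply: le_pr; [exact: measurable_setY| |].
  by apply: measurableU; exact: measurable_setY.
move=> x /=; case: (pselect (B x)); tauto.
Qed.

Lemma pr_bigcup_approx (A : nat -> set X) (e : R) : 0 < e ->
  (forall i, measurable (A i)) ->
  exists n, pr (\bigcup_i A i `+` \big[setU/set0]_(i < n) A i) <= e.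
Proof.
move=> e0 mA; pose F n := \big[setU/set0]_(i < n) A i.
have mF n : measurable (F n) by exact: bigsetU_measurable.
have UF : \bigcup_n F n = \bigcup_n A n.
  apply/seteqP; split=> [x [n _]|x [n _ Anx]].
    exact: bigsetU_bigcup.
  by exists n.+1 => //; rewrite /F big_ord_recr; right.
have mUA : measurable (\bigcup_n A n) by exact: bigcup_measurable.
have : mu (F n) @[n --> \oo] --> mu (\bigcup_n A n).
  rewrite -UF; apply: nondecreasing_cvg_mu => //; first by rewrite UF.
  by apply/nondecreasing_seqP => n; rewrite /F big_ord_recr;
    apply/subsetPset; left.
rewrite -(prE mUA) => /fine_cvg/cvgrPdist_le/(_ e e0)[n _ /(_ n (leqnn n))].
rewrite -/(pr (F n)) => FA; exists n; apply: le_trans FA.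
have FnA : F n `<=` \bigcup_i A i by exact: bigsetU_bigcup.
rewrite /setY (_ : \big[setU/set0]_(i < n) A i `\` _ = set0); last first.
  by apply/seteqP; split=> // x [/FnA].
rewrite setU0 -/(F n) /pr measureD//.
  rewrite setIidr// fineB ?fin_num_measure//; exact: ler_norm.
by rewrite ltey_eq fin_num_measure.
Qed.

End Probability.

Section Approximable.
Context {R : realType} {G : groupType}.
Context {d : measure_display} {X : measurableType d} {mu : probability X R}.
Variables (T : G -> X -> X) (hT : mp_action mu T).
Variable b : observable mu.

(** The sets measurable with respect to the finite join of the translates of [b]
    by [L]. *)
Definition determined (L : seq G) (B : set X) : Prop :=
  exists E, B = orbit_join hT b L @^-1` E.

Lemma determinedP L B : determined L B <->
  forall x y, orbit_join hT b L x = orbit_join hT b L y -> B x -> B y.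
Proof.
split=> [[E ->] x y /= -> //|BL]; exists (orbit_join hT b L @` B).
apply/seteqP; split=> [x Bx|x [y By yx]]; first by exists x.
exact: BL By.
Qed.

Lemma measurable_determined L B : determined L B -> measurable B.
Proof.
by move=> [E ->]; apply: measurable_label_preimage; exact: measurable_observable.
Qed.

Lemma determined_sub L L' B : {subset L <= L'} ->
  determined L B -> determined L' B.
Proof.
move=> LL' /determinedP BL; apply/determinedP => x y /orbit_labelP xy.
by apply: BL; apply/orbit_labelP => g /LL'/xy.
Qed.

(** The closure, for the pseudometric of symmetric differences, of the algebra
    of sets determined by finitely many translates of [b]. *)
Definition approximable (A : set X) : Prop :=
  measurable A /\ forall e : R, 0 < e ->
    exists L B, determined L B /\ pr mu (A `+` B) <= e.

Lemma approximableC A : approximable A -> approximable (~` A).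
Proof.
move=> [mA hA]; split=> [|e /hA[L [B [BL AB]]]]; first exact: measurableC.
exists L, (~` B); split.
  by case: BL => E ->; exists (~` E).
congr (_ <= _): AB; congr pr; apply/seteqP; split=> x /=;
  case: (pselect (A x)); case: (pselect (B x)); tauto.
Qed.

Lemma approximableU A A' : approximable A -> approximable A' ->
  approximable (A `|` A').
Proof.
move=> [mA hA] [mA' hA']; split=> [|e e0]; first exact: measurableU.
have [L [B [BL AB]]] := hA (e / 2) (divr_gt0 e0 (ltr0Sn _ _)).
have [L' [B' [BL' AB']]] := hA' (e / 2) (divr_gt0 e0 (ltr0Sn _ _)).
have mB := measurable_determined BL; have mB' := measurable_determined BL'.
exists (L ++ L'), (B `|` B'); split.
  have /determinedP Bd : determined (L ++ L') B.
    by apply: determined_sub BL => g gL; rewrite mem_cat gL.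
  have /determinedP Bd' : determined (L ++ L') B'.
    by apply: determined_sub BL' => g gL; rewrite mem_cat gL orbT.
  by apply/determinedP => x y xy [/(Bd _ _ xy)|/(Bd' _ _ xy)]; [left|right].
rewrite [e]splitr; apply: le_trans (lerD AB AB').
apply: le_trans (prU _ _ _); try exact: measurable_setY.
apply: le_pr; [|by apply: measurableU; exact: measurable_setY|].
  by apply: measurable_setY; exact: measurableU.
by move=> x /=; tauto.
Qed.

Lemma approximable0 : approximable set0.
Proof.
split=> // e e0; exists [::], set0; split.
  by exists set0; rewrite preimage_set0.
by rewrite setYK /pr measure0 ltW.
Qed.

Lemma approximable_near A A' : measurable A -> approximable A' ->
  pr mu (A `+` A') <= 0 -> approximable A.
Proof.
move=> mA [mA' hA'] AA'; split=> // e /hA'[L [B [BL A'B]]].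
exists L, B; split=> //; rewrite -[e]add0r.
apply: le_trans (lerD AA' A'B); apply: pr_setY_trans => //.
exact: measurable_determined BL.
Qed.

(** A countable union is nearly exhausted by finitely many of its members. *)
Lemma approximable_bigcup (A : nat -> set X) : (forall i, approximable (A i)) ->
  approximable (\bigcup_i A i).
Proof.
move=> hA; have mA i : measurable (A i) by case: (hA i).
have fin n : approximable (\big[setU/set0]_(i < n) A i).
  elim: n => [|n ih]; first by rewrite big_ord0; exact: approximable0.
  by rewrite big_ord_recr; exact: approximableU.
split=> [|e e0]; first exact: bigcup_measurable.
have e20 : 0 < e / 2 by rewrite divr_gt0.
have [n An] := pr_bigcup_approx mu e20 mA.
have [mF /(_ _ e20)[L [B [BL FB]]]] := fin n.
exists L, B; split=> //; rewrite [e]splitr.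
apply: le_trans (lerD An FB); apply: pr_setY_trans => //.
  exact: bigcup_measurable.
exact: measurable_determined BL.
Qed.

(** The preimage under [T g] of a set determined by [L] is determined by
    [translate L g]. *)
Lemma approximable_shift g A : approximable A -> approximable (T g @^-1` A).
Proof.
have mg (C : set X) : measurable C -> measurable (T g @^-1` C).
  by move=> mC; rewrite -[_ @^-1` _]setTI; apply: (hT.1 g).1.
move=> [mA hA]; split=> [|e /hA[L [B [BL AB]]]]; first exact: mg.
have mB := measurable_determined BL.
exists (translate L g), (T g @^-1` B); split.
  apply/determinedP => x y; rewrite !orbit_join_translate => xy.
  by move/determinedP: BL => /(_ (T g x) (T g y)); exact.
apply: le_trans AB; rewrite le_eqVlt; apply/orP; left; apply/eqP.
by congr fine; apply: (hT.1 g).2 (measurable_setY mA mB).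
Qed.

Lemma invariant_approximable : invariant_sigma_algebra T approximable.
Proof.
split; last by move=> g A; exact: approximable_shift.
split; first exact: approximable0.
  by move=> A hA; rewrite setTD; exact: approximableC.
exact: approximable_bigcup.
Qed.

Lemma approximable_fiber k : approximable (b @^-1` [set k]).
Proof.
have mb := measurable_observable b.
split=> // e e0; exists [:: 1%g], (T 1%g @^-1` (b @^-1` [set k])); split.
  by apply/determinedP => x y [/= ->].
suff -> : pr mu (b @^-1` [set k] `+` T 1%g @^-1` (b @^-1` [set k])) = 0.
  exact: ltW.
have [Z [mZ Z0 bZ]] := ae_shift1 hT b.
rewrite /pr (subset_measure0 _ _ _ Z0)//.
  apply: measurable_setY => //; rewrite -[_ @^-1` (_ @^-1` _)]setTI.
  exact: (hT.1 1%g).1.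
move=> x xb; apply: bZ => /= bx; move: xb => /=; rewrite bx; tauto.
Qed.

(** The approximable sets form an invariant sigma-algebra containing the pieces
    of [alpha], hence all the sets in the one that [alpha] generates; they are
    also stable under null perturbations. *)
Lemma approximable_generating (alpha : set (set X)) :
  generating mu T alpha ->
  (forall P, alpha P -> P !=set0 -> exists k, P = b @^-1` [set k]) ->
  forall A, measurable A -> approximable A.
Proof.
move=> [_ gen] fib A mA; have [B BM AB] := gen A mA.
have hB : approximable B.
  apply: BM; split=> [|P aP]; first exact: invariant_approximable.
  have [->|/set0P] := eqVneq P set0; first exact: approximable0.
  by move=> /(fib _ aP)[k ->]; exact: approximable_fiber.
by apply: approximable_near hB _ => //; rewrite /pr AB.
Qed.

End Approximable.

(** * Continuity of entropy *)

Section Continuity.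
Context {R : realType}.

Lemma esum_finType (K : finType) (f : K -> \bar R) : (forall k, (0 <= f k)%E) ->
  (\esum_(k in [set: K]) f k = \sum_(k : K) f k)%E.
Proof.
move=> f0; rewrite esum_fset => [||k _]; [|exact: finite_finset|exact: f0].
rewrite (fsbigE (index_enum K)) ?index_enum_uniq//.
  by apply: eq_bigl => k; apply: mem_set.
by move=> i _; rewrite mem_index_enum.
Qed.

(** With [x = y ^+ 2] this is [y * ln y^-1 <= 1], multiplied by [2 y]. *)
Lemma eta_le_sqrt (x : R) : 0 <= x -> - (x * ln x) <= 2 * Num.sqrt x.
Proof.
move=> x0; have [->|xn0] := eqVneq x 0.
  by rewrite mul0r oppr0 mulr_ge0 ?sqrtr_ge0.
have xp : 0 < x by rewrite lt_neqAle eq_sym xn0.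
set y := Num.sqrt x; have yp : 0 < y by rewrite sqrtr_gt0.
have -> : x = y ^+ 2 by rewrite sqr_sqrtr.
rewrite lnXn// mulr2n.
have : ln y^-1 <= y^-1.
  by apply/ltW/ln_sublinear; rewrite invr_gt0.
rewrite lnV ?posrE// => /(ler_wpM2l (ltW yp)); rewrite mulfV ?gt_eqF// => H.
have := ler_wpM2l (ltW yp) H; rewrite expr2; lra.
Qed.

(** The increment of [x * ln x] is split as
    [(v - u) * ln v + u * (ln v - ln u)]; the first part is nonpositive and the
    second is at most [v - u]. *)
Lemma eta_le_diff (u v : R) : 0 <= u -> u <= v -> v <= 1 ->
  - (u * ln u) <= - (v * ln v) + (v - u).
Proof.
move=> u0 uv v1; have [->|un0] := eqVneq u 0.
  rewrite mul0r oppr0 addr0 addr_ge0 ?(le_trans u0 uv)// eta_ge0//.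
  by rewrite v1 (le_trans u0 uv).
have up : 0 < u by rewrite lt_neqAle eq_sym un0.
have vp : 0 < v by exact: lt_le_trans uv.
have h1 : u * (ln v - ln u) <= v - u.
  have : ln (v / u) <= v / u - 1.
    by rewrite -{1}[v / u](subrKC 1) le_ln1Dx// ltrBrDl subrr divr_gt0.
  rewrite ln_div ?posrE// => /(ler_wpM2l u0).
  have -> // : u * (v / u - 1) = v - u.
  by rewrite mulrBr mulr1 mulrCA mulfV// mulr1.
have h2 : (v - u) * ln v <= 0.
  by rewrite mulr_ge0_le0 ?subr_ge0// ln_le0.
lra.
Qed.

Context {d : measure_display} {X : measurableType d}.
Variable mu : probability X R.

Lemma mass_sum (K : finType) (L : countType) (a : X -> K) (b : X -> L) j :
  measurable_label a -> measurable_label b ->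
  mass mu b j = \sum_(i : K) mass mu (pair_label a b) (i, j).
Proof.
move=> ma mb; have := esum_mass_pairl mu j ma mb ler01.
rewrite mulr1 esum_finType => [|i]; last by rewrite mulr1 lee_fin mass_ge0.
under eq_bigr do rewrite mulr1.
by rewrite sumEFin => -[].
Qed.

Lemma shannon_finType (K : finType) (a : X -> K) : measurable_label a ->
  shannon mu a = (\sum_(k : K) - (mass mu a k * ln (mass mu a k)))%:E.
Proof.
move=> ma; rewrite /shannon esum_finType ?sumEFin// => k.
by rewrite lee_fin mass_eta_ge0.
Qed.

(** A form of Fano's inequality: in the joint law the off-diagonal masses are at
    most [e], and each diagonal mass differs from the mass of [b] by the
    off-diagonal masses of its column. *)
Lemma shannon_fano (K : finType) (a b : X -> K) (e : R) : 0 <= e ->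
  measurable_label a -> measurable_label b ->
  pr mu [set x | a x != b x] <= e ->
  (shannon mu (pair_label a b) <=
   shannon mu b + ((#|K| * #|K|)%:R * (e + 2 * Num.sqrt e))%:E)%E.
Proof.
move=> e0 ma mb abe.
have mab : measurable_label (pair_label a b) by exact: measurable_pair_label.
pose w := mass mu (pair_label a b).
have w0 p : 0 <= w p by exact: mass_ge0.
have mE : measurable [set x | a x != b x].
  rewrite (_ : [set _ | _] = pair_label a b @^-1` [set p | p.1 != p.2])//.
  exact: measurable_label_preimage.
have woff i j : i != j -> w (i, j) <= e.
  move=> ij; apply: le_trans abe; apply: le_pr => //.
  by move=> x [/= -> ->].
have pairE (H : K * K -> R) :
    \sum_(p : K * K) H p = \sum_(j : K) \sum_(i : K) H (i, j).
  by rewrite exchange_big pair_big/=; apply: eq_bigr => -[].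
rewrite (shannon_finType mab) (shannon_finType mb) -EFinD lee_fin pairE.
have -> : (#|K| * #|K|)%:R * (e + 2 * Num.sqrt e) =
    \sum_(j : K) \sum_(i : K) (e + 2 * Num.sqrt e).
  by rewrite !sumr_const -mulrnA mulr_natl.
rewrite -big_split; apply: ler_sum => j _ /=.
rewrite [leLHS](bigD1 j)//= [in leRHS](bigD1 j)//=.
have sqrt0 : 0 <= Num.sqrt e by exact: sqrtr_ge0.
have wj : mass mu b j = w (j, j) + \sum_(i | i != j) w (i, j).
  by rewrite (mass_sum j ma mb) (bigD1 j).
have woff0 : 0 <= \sum_(i | i != j) w (i, j) by exact: sumr_ge0.
have diag : - (w (j, j) * ln (w (j, j))) <=
    - (mass mu b j * ln (mass mu b j)) + \sum_(i | i != j) w (i, j).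
  apply: le_trans (eta_le_diff _ _ (mass_le1 mu j mb)) _ => //.
    by rewrite wj lerDl.
  by rewrite wj lerD2l; lra.
have off : \sum_(i | i != j) w (i, j) +
    \sum_(i | i != j) - (w (i, j) * ln (w (i, j))) <=
    \sum_(i | i != j) (e + 2 * Num.sqrt e).
  rewrite -big_split; apply: ler_sum => i ij; apply: lerD; first exact: woff.
  apply: le_trans (eta_le_sqrt _) _ => //.
  by rewrite ler_pM2l// ler_sqrt// woff.
move: diag off; rewrite -/w; set A := \sum_(i | _) w _.
lra.
Qed.

Lemma fano_modulus (n : nat) (e : R) : 0 < e ->
  exists2 t, 0 < t & n%:R * (t + 2 * Num.sqrt t) <= e.
Proof.
move=> e0; pose y := Num.min 1 (e / (3 * (n%:R + 1))).
have n0 : 0 <= n%:R :> R by [].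
have dp : 0 < 3 * (n%:R + 1) :> R by lra.
have yp : 0 < y by rewrite /y lt_min ltr01 divr_gt0.
have y1 : y <= 1 by rewrite /y ge_min lexx.
have ye : 3 * (n%:R + 1) * y <= e.
  by rewrite mulrC -ler_pdivlMr// /y ge_min lexx orbT.
exists (y ^+ 2); first by rewrite exprn_gt0.
rewrite sqrtr_sqr (ger0_norm (ltW yp)).
have : y ^+ 2 <= y by rewrite expr2 ler_piMl// ltW.
move=> yy; apply: le_trans ye; nra.
Qed.

Section Truncation.
Variable b : observable mu.

Definition truncate (n : nat) : observable mu :=
  @coarsening _ _ _ _ b _ (fun k => inord (minn (pickle k) n) : 'I_n.+1).

(** The entropy of [b] is nearly reached by a finite sum, over labels which
    truncation beyond their codes keeps apart. *)
Lemma ent_truncate (e : R) : 0 < e -> exists n, ent b <= ent (truncate n) + e.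
Proof.
move=> e0; have mb := measurable_observable b.
have fb : shannon mu b \is a fin_num by rewrite -entE.
have [_ [A [finA _] <-] Ae] := ub_ereal_sup_adherent e0 fb.
have [A_seq AE] := (finite_seqP A).1 finA.
pose n := (\big[maxn/0%N]_(k <- A_seq) pickle k).+1.
have An k : A k -> (pickle k < n)%N.
  by rewrite AE /= ltnS => kl; exact: (leq_bigmax_seq k).
exists n; pose h (k : alphabet b) : 'I_n.+1 := inord (minn (pickle k) n).
have hA k l : A k -> h l = h k -> l = k.
  move=> /An kn /(congr1 val); rewrite /= !inordK ?ltnS ?geq_minr//.
  rewrite [in RHS](minn_idPl (ltnW kn)) => lk; apply: (pcan_inj (@pickleK _)).
  by move: kn; rewrite -lk /minn; case: ifP => // _; rewrite ltnn.
rewrite -lee_fin EFinD -leeBlDr// !entE; apply: le_trans (ltW Ae) _.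
apply: esum_ge; exists (h @` A).
  by split=> //; exact: finite_image.
rewrite fsbig_image; last by move=> k l /[!inE] _ Al; exact: hA.
apply: lee_fsum => // k Ak; rewrite lee_fin.
suff -> : mass mu (truncate n) (h k) = mass mu b k by [].
congr (fine (mu _)); apply/seteqP; split=> x /=; first exact: hA.
by move=> ->.
Qed.

Lemma cond_ent_truncate (e : R) : 0 < e ->
  exists n, cond_ent b (truncate n) <= e /\ cond_ent (truncate n) b <= 0.
Proof.
move=> e0; have [n bn] := ent_truncate e0; exists n.
have bt : refines mu b (truncate n) by apply: refines_fun => x y /= ->.
rewrite /cond_ent (@ent_eq _ _ _ _ (join b _) b); [|exact: refines_fst|
  exact: refines_join (refines_refl _ _) bt].
rewrite (@ent_eq _ _ _ _ (join _ b) b); [|exact: refines_snd|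
  exact: refines_join bt (refines_refl _ _)].
by split; lra.
Qed.

End Truncation.

End Continuity.

(** * Approximation of observables *)

Section Approximation.
Context {R : realType} {G : groupType}.
Context {d : measure_display} {X : measurableType d} {mu : probability X R}.
Variables (T : G -> X -> X) (hT : mp_action mu T).
Variable b : observable mu.
Hypothesis hb : forall A, measurable A -> approximable hT b A.

(** Each of the first [n] fibres of [a] is close to a set determined by finitely
    many translates of [b].  These sets need not be disjoint, so a point is
    labelled by the first one containing it, and by the last label [n] if there
    is none; an error occurs only in one of the symmetric differences. *)
Lemma approximate_label n (a : X -> 'I_n.+1) (e : R) :
  measurable_label a -> 0 < e ->
  exists L (h : seq (alphabet b) -> 'I_n.+1),
    pr mu [set x | a x != h (orbit_join hT b L x)] <= e.
Proof.
move=> ma e0; pose e' := e / n.+1%:R.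
have e'0 : 0 < e' by rewrite divr_gt0.
pose A i := [set x | a x = i :> nat].
have mA i : measurable (A i).
  rewrite (_ : A i = a @^-1` [set k | k = i :> nat])//.
  exact: measurable_label_preimage.
have /choice[f hf] i : exists LB : seq G * set X,
    determined hT b LB.1 LB.2 /\ pr mu (A i `+` LB.2) <= e'.
  by have [_ /(_ _ e'0)[L [B LB]]] := hb (mA i); exists (L, B).
pose L := flatten [seq (f i).1 | i <- iota 0 n].
have /choice[E hE] i : exists E, (i < n)%N -> (f i).2 = orbit_join hT b L @^-1` E.
  have [i_n|] := boolP (i < n)%N; last by exists set0.
  have [|E fE] := @determined_sub _ _ _ _ _ _ hT b (f i).1 L (f i).2 _ (hf i).1.
    by move=> g gi; apply/flatten_mapP; exists i; rewrite ?mem_iota.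
  by exists E.
exists L, (fun l => inord (find (fun i => `[< E i l >]) (iota 0 n))).
pose D i := A i `+` (f i).2.
have mD i : measurable (D i).
  by apply: measurable_setY => //; exact: measurable_determined (hf i).1.
have De i : pr mu (D i) <= e' by case: (hf i).
apply: (@le_trans _ _ (pr mu (\big[setU/set0]_(i < n) D i))); last first.
  apply: le_trans (pr_bigsetU n mD De) _; rewrite /e' mulrCA ler_piMr ?ltW//.
  by rewrite ltr_pdivrMr// mul1r ltr_nat.
apply: le_pr.
- rewrite (_ : [set _ | _] = pair_label a (orbit_join hT b L) @^-1`
    [set p | p.1 != inord (find (fun i => `[< E i p.2 >]) (iota 0 n))])//.
  apply: measurable_label_preimage; apply: measurable_pair_label => //.
  exact: measurable_observable.
- exact: bigsetU_measurable.
move=> x /=; apply: contraNP => nD; apply/eqP/val_inj => /=.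
have inE i : (i < n)%N -> `[< E i (orbit_join hT b L x) >] = (i == a x).
  move=> i_n; apply/idP/idP.
    move=> /asboolP Ei; apply/eqP; apply: contrapT => ai; apply: nD.
    rewrite -bigcup_mkord; exists i => //; right; split; first by rewrite hE.
    by move=> axi; apply: ai; rewrite axi.
  move=> /eqP ai; apply/asboolP; apply: contrapT => nEi; apply: nD.
  rewrite -bigcup_mkord; exists i => //; left; split=> //.
  by rewrite hE.
rewrite (@eq_in_find _ _ (pred1 (a x : nat))); last first.
  by move=> i; rewrite mem_iota => /andP[_ i_n]; exact: inE.
rewrite -/(index _ _) inordK; last first.
  by rewrite ltnS -[X in (_ <= X)%N](size_iota 0 n) index_size.
have := ltn_ord (a x); rewrite ltnS leq_eqVlt => /orP[/eqP ax|ax].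
  by rewrite memNindex ?size_iota// ax mem_iota ltnn andbF.
rewrite -[in RHS](add0n (a x : nat)) -(nth_iota 0 0 ax).
by rewrite index_uniq ?size_iota ?iota_uniq.
Qed.

(** Truncation reduces to finitely many labels, where small probability of error
    means small conditional entropies in both directions. *)
Lemma approximate_observable (a : observable mu) (e : R) : 0 < e ->
  exists (L : seq G) (a' : observable mu),
    [/\ refines mu (orbit_join hT b L) a', cond_ent a a' <= e & cond_ent a' a <= e].
Proof.
move=> e0; have e20 : 0 < e / 2 by rewrite divr_gt0.
have [n [an na]] := cond_ent_truncate a e20.
set c := truncate a n in an na.
pose N := (#|'I_n.+1| * #|'I_n.+1|)%N.
have [t t0 tN] := fano_modulus N e20.
have mc : measurable_label (c : X -> 'I_n.+1) := measurable_observable c.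
have [L [h ch]] := approximate_label mc t0.
pose a' := @coarsening _ _ _ _ (orbit_join hT b L) _ h.
have ma' : measurable_label (a' : X -> 'I_n.+1) := measurable_observable a'.
have hc : pr mu [set x | (a' : X -> 'I_n.+1) x != (c : X -> 'I_n.+1) x] <= t.
  by congr (_ <= _): ch; congr pr; apply/seteqP; split=> x /=; rewrite eq_sym.
exists L, a'.
have ca' : cond_ent c a' <= e / 2.
  have := shannon_fano (ltW t0) mc ma' ch.
  rewrite -(entE (join c a')) -(entE a') -EFinD lee_fin /cond_ent -/N; lra.
have a'c : cond_ent a' c <= e / 2.
  have := shannon_fano (ltW t0) ma' mc hc.
  rewrite -(entE (join a' c)) -(entE c) -EFinD lee_fin /cond_ent -/N; lra.
split; first by apply: refines_fun => x y /= ->.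
- by have := cond_ent_triangle a c a'; lra.
- by have := cond_ent_triangle a' c a; lra.
Qed.

End Approximation.

(** * Change of generator *)

Section Main.
Context {R : realType} {r : nat} {G : groupType} (s : 'I_r -> G).
Hypothesis hG : free_generators s.
Context {d : measure_display} {X : measurableType d} {mu : probability X R}.
Variables (T : G -> X -> X) (hT : mp_action mu T).

(** Bowen's invariance theorem, one inequality of it; the roles of [a] and [b]
    can be exchanged. *)
Lemma F_obs_orbit_join_generating (b a : observable mu) :
  (forall A, measurable A -> approximable hT b A) ->
  (forall A, measurable A -> approximable hT a A) ->
  forall e : R, 0 < e ->
    exists n, F_obs s hT (orbit_join hT b (ball_seq s n)) <= F_obs s hT a + e.
Proof.
move=> hb ha e e0.
have e40 : 0 < e / 4 by rewrite divr_gt0.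
have [L1 [b' [L1b' bb' _]]] := approximate_observable ha b e40.
have [m L1m] := ball_seq_cover hG L1.
have b_am : cond_ent b (orbit_join hT a (ball_seq s m)) <= e / 4.
  apply: le_trans bb'; apply: cond_ent_antitone.
  exact: refines_trans (orbit_join_sub hT a L1m) L1b'.
(* [t] must beat the error in [H (b | a'^m)], which is multiplied by the size of
   the ball, together with the Lipschitz constant of [F_obs_perturb] *)
pose M := (size (ball_seq s m) + (1 + 4 * r))%N.
pose t := e / 2 / M%:R.
have Mp : 0 < M%:R :> R by rewrite ltr0n /M addnC.
have t0 : 0 < t by rewrite !divr_gt0.
have tM : (size (ball_seq s m))%:R * t + (1 + 4 * r%:R) * t = e / 2.
  have -> : (size (ball_seq s m))%:R * t + (1 + 4 * r%:R) * t = M%:R * t.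
    have -> : M%:R = (size (ball_seq s m))%:R + (1 + 4 * r%:R) :> R.
      by rewrite /M natrD natrD natrM.
    by rewrite -mulrDl.
  by rewrite /t mulrCA mulfV ?mulr1// gt_eqF.
have [L2 [a' [L2a' aa' a'a]]] := approximate_observable hb a t0.
pose k := orbit_join hT a' (ball_seq s m).
have [n Ln] := ball_seq_cover hG [seq (g * h)%g | g <- L2, h <- ball_seq s m].
exists n.
have kb : refines mu (orbit_join hT b (ball_seq s n)) k.
  apply: refines_orbit_join => h hm.
  apply: refines_trans (refines_shift hT h L2a').
  apply/refines_orbit_join_translate/orbit_join_sub => _ /mapP[g gL ->].
  by apply: Ln; apply: allpairs_f.
have Fk : F_obs s hT k <= F_obs s hT a'.
  by apply: F_obs_orbit_join_le; [exact: refines_refl|exact: orbit_join_ball_self].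
have Fa' : F_obs s hT a' <= F_obs s hT a + (1 + 4 * r%:R) * t.
  exact: F_obs_perturb.
have ck : cond_ent b k <= e / 4 + (size (ball_seq s m))%:R * t.
  apply: le_trans (cond_ent_triangle b (orbit_join hT a (ball_seq s m)) k) _.
  apply: lerD b_am _; apply: le_trans (cond_ent_orbit_join _ _ _ _) _.
  by rewrite ler_wpM2l.
have Fj := F_obs_join s hT k b.
have : F_obs s hT (orbit_join hT b (ball_seq s n)) <= F_obs s hT (join k b).
  apply: F_obs_orbit_join_le; first exact: refines_snd.
  exact/refines_join/orbit_join_ball_self.
lra.
Qed.

End Main.

(** * From labellings to partitions *)

Section Codes.
Context {X : Type}.

(** The empty set may belong to [P], as it may to a join of partitions; it does
    not affect the entropy. *)
Definition codes (K : Type) (b : X -> K) (P : set (set X)) : Prop :=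
  (forall A x, P A -> A x -> A = [set y | b y = b x]) /\
  (forall x, exists2 A, P A & A x).

Lemma codes_comp (K : Type) (b : X -> K) P (t : X -> X) :
  codes b P -> codes (b \o t) (partition_preim t P).
Proof.
move=> [bP cP]; split=> [_ x [A PA <-] Atx|x].
  by rewrite (bP A (t x) PA Atx).
by have [A PA Atx] := cP (t x); exists (t @^-1` A) => //; exists A.
Qed.

Lemma codes_join (K L : Type) (a : X -> K) (b : X -> L) P Q :
  codes a P -> codes b Q ->
  codes (fun x => (a x, b x)) (partition_join P Q).
Proof.
move=> [aP cP] [bQ cQ]; split=> [_ x [A PA] [B QB] <- [Ax Bx]|x].
  rewrite (aP A x PA Ax) (bQ B x QB Bx); apply/seteqP.
  by split=> y /= [-> ->].
have [A PA Ax] := cP x; have [B QB Bx] := cQ x.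
by exists (A `&` B) => //; exists A => //; exists B.
Qed.

Lemma codes_bigjoin (I : eqType) (K : Type) (D : set I) (L : seq I)
    (b : I -> X -> K) (P : I -> set (set X)) :
  (forall i, i \in L <-> D i) -> (forall i, codes (b i) (P i)) ->
  codes (fun x => [seq b i x | i <- L]) (bigjoin D P).
Proof.
move=> DL bP; split=> [_ x [c [cP ->]] cx|x].
  apply/seteqP; split=> y /=.
    move=> cy; apply/eq_in_map => i /DL Di.
    by have /= := cy i Di; rewrite ((bP i).1 _ _ (cP i Di) (cx i Di)).
  move=> /eq_in_map bxy i Di; rewrite ((bP i).1 _ _ (cP i Di) (cx i Di)) /=.
  exact/bxy/DL.
have /choice[c cP] i : exists A, P i A /\ A x.
  by have [A PA Ax] := (bP i).2 x; exists A.
exists (\bigcap_(i in D) c i); last by move=> i _; exact: (cP i).2.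
by exists c; split=> // i _; exact: (cP i).1.
Qed.

End Codes.

Section Bridge.
Context {R : realType} {d : measure_display} {X : measurableType d}.
Variable mu : probability X R.

(** Up to the empty piece on one side and labels outside the range of [b] on the
    other, which contribute nothing, [k |-> b @^-1` [set k]] is a bijection
    between the index sets of the two sums. *)
Lemma entropy_codes (K : countType) (b : X -> K) P : measurable_label b ->
  codes b P -> entropy mu P = shannon mu b.
Proof.
move=> mb [bP cP]; pose f k := b @^-1` [set k].
pose g (A : set X) := (- (fine (mu A) * ln (fine (mu A))))%:E.
have g0 A : P A -> (0 <= g A)%E.
  have [->|/set0P[x Ax] PA] := eqVneq A set0.
    by rewrite /g measure0 mul0r oppr0.
  by rewrite (bP A x PA Ax) lee_fin (mass_eta_ge0 mu (b x) mb).
rewrite /entropy -/g (esumID [set set0])// esum1 ?add0e; last first.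
  by move=> A [_ /= ->]; rewrite measure0 mul0r oppr0.
rewrite /shannon (esumID (range b)) => [|k _]; last first.
  by rewrite lee_fin mass_eta_ge0.
rewrite [X in _ = (_ + X)%E]esum1 ?adde0 ?setTI; last first.
  move=> k /= nk; rewrite /mass (_ : _ @^-1` _ = set0).
    by rewrite measure0 mul0r oppr0.
  by rewrite -subset0 => x /= bx; apply: nk; exists x.
transitivity (\esum_(A in f @` range b) g A)%E; last first.
  rewrite esum_image// => k l /[!inE] -[x _ <-] _ fkl.
  have : f (b x) x by [].
  by rewrite fkl.
congr esum; apply/seteqP; split=> [A [PA /= /eqP/set0P[x Ax]]|_ [_ [x _ <-] <-]].
  by exists (b x); [exists x|rewrite (bP A x PA Ax)].
have [A PA Ax] := cP x; have AE := bP A x PA Ax.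
split=> /=; first by rewrite /f (_ : _ @^-1` _ = A)// AE.
by move=> f0; have : f (b x) x by []; rewrite f0.
Qed.

Lemma countable_partition_codes (P : set (set X)) : countable_partition P ->
  exists2 b : X -> nat, measurable_label b & codes b P.
Proof.
move=> [/countable_injP[f finj] mP tP cP].
have /choice[piece pieceP] x : exists A, P A /\ A x.
  have : (\bigcup_(A in P) A) x by rewrite cP.
  by move=> [A PA Ax]; exists A.
have pieceE A x : P A -> A x -> A = piece x.
  move=> PA Ax; apply: tP => //; first exact: (pieceP x).1.
  by exists x; split=> //; exact: (pieceP x).2.
have bE x y : f (piece y) = f (piece x) <-> piece x y.
  split=> [fxy|xy]; last by rewrite -(pieceE _ y (pieceP x).1 xy).
  have <- : piece y = piece x.
    by apply: finj => //; rewrite inE; [exact: (pieceP y).1|exact: (pieceP x).1].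
  exact: (pieceP y).2.
exists (fun x => f (piece x)).
  move=> k; have [[x xk]|nk] := pselect (exists x, f (piece x) = k).
    rewrite (_ : _ @^-1` _ = piece x); first exact/mP/(pieceP x).1.
    by apply/seteqP; split=> y /=; rewrite -xk => /bE.
  rewrite (_ : _ @^-1` _ = set0)// -subset0 => x /= xk.
  by apply: nk; exists x.
split=> [A x PA Ax|x]; last first.
  by exists (piece x); [exact: (pieceP x).1|exact: (pieceP x).2].
by rewrite [in LHS](pieceE A x PA Ax); apply/seteqP; split=> y /= /bE.
Qed.

Lemma observable_of_partition (P : set (set X)) :
  countable_partition P -> (entropy mu P < +oo)%E ->
  exists b : observable mu, codes b P.
Proof.
move=> /countable_partition_codes[b mb bP]; rewrite (entropy_codes mb bP) => fb.
by exists (Observable mb fb).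
Qed.

Lemma entropy_ent (b : observable mu) P : codes b P ->
  entropy mu P = (ent b)%:E.
Proof.
by move=> bP; rewrite entE (entropy_codes (measurable_observable b) bP).
Qed.

Lemma finite_entropy (P : set (set X)) : finite_set P -> P `<=` measurable ->
  (entropy mu P < +oo)%E.
Proof.
move=> fP mP; rewrite /entropy esum_fset//.
  by rewrite fsbig_finite//= sumEFin ltry.
move=> A /[!inE] PA; rewrite lee_fin eta_ge0// fine_ge0//=.
by rewrite -lee_fin fineK ?fin_num_measure ?probability_le1//; exact: mP.
Qed.

End Bridge.

Section FBridge.
Context {R : realType} {r : nat} {G : groupType} (s : 'I_r -> G).
Context {d : measure_display} {X : measurableType d} {mu : probability X R}.
Variables (T : G -> X -> X) (hT : mp_action mu T).

Lemma F_functional_F_obs (b : observable mu) P : codes b P ->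
  F_functional s mu T P = (F_obs s hT b)%:E.
Proof.
move=> bP; rewrite /F_functional (entropy_ent bP) /F_obs [RHS]EFinD [in RHS]EFinM.
congr (_ + _)%E; rewrite -sumEFin; apply: eq_bigr => i _.
apply: (entropy_ent (b := join b (shift hT (s i) b))).
exact: codes_join bP (codes_comp _ bP).
Qed.

Lemma codes_ball_join (b : observable mu) P n : codes b P ->
  codes (orbit_join hT b (ball_seq s n)) (ball_join s T P n).
Proof.
move=> bP; apply: (@codes_bigjoin _ _ _ (word_ball s n) (ball_seq s n)
  (fun g => b \o T g)).
  by move=> g; split=> /mem_ball_seq.
by move=> g; exact: codes_comp.
Qed.

Lemma f_partition_F_obs (b : observable mu) P : codes b P ->
  f_partition s mu T P =
  ereal_inf (range (fun n => (F_obs s hT (orbit_join hT b (ball_seq s n)))%:E)).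
Proof.
move=> bP; rewrite /f_partition; congr ereal_inf.
by apply: eq_imagel => n _; exact/F_functional_F_obs/codes_ball_join.
Qed.

Lemma f_invariantP (a : set (set X)) : finite_set a -> generating mu T a ->
  exists (P : set (set X)) (b : observable mu),
    [/\ generating mu T P, codes b P &
        f_invariant s mu T =
        ereal_inf (range (fun n => (F_obs s hT (orbit_join hT b (ball_seq s n)))%:E))].
Proof.
move=> fa ga; have [[_ ma _ _] _] := ga.
have [] : [set v | exists alpha : set (set X),
    [/\ generating mu T alpha, (entropy mu alpha < +oo)%E &
        v = f_partition s mu T alpha]] (f_invariant s mu T).
  by apply: (xgetPex 0%E); exists (f_partition s mu T a), a; split=> //;
    exact: finite_entropy.
move=> P [gP fP ->]; have [b bP] := observable_of_partition gP.1 fP.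
by exists P, b; split=> //; exact: f_partition_F_obs.
Qed.

Lemma codes_approximable (b : observable mu) P : generating mu T P ->
  codes b P -> forall A, measurable A -> approximable hT b A.
Proof.
move=> gP bP; apply: approximable_generating gP _ => A PA [x Ax].
by exists (b x); exact: bP.1.
Qed.

(** Everything determined by translates of [b] is determined by translates of a
    finer labelling: a refinement of a generator generates. *)
Lemma approximable_refines (b c : observable mu) A :
  (forall x y, c x = c y -> b x = b y) ->
  approximable hT b A -> approximable hT c A.
Proof.
move=> cb [mA hA]; split=> // e /hA[L [B [/determinedP BL AB]]].
exists L, B; split=> //; apply/determinedP => x y /orbit_labelP xy.
by apply: BL; apply/orbit_labelP => g /xy/cb.
Qed.

End FBridge.

(** * Factors *)

Section Factor.
Context {R : realType} {r : nat} {G : groupType} (s : 'I_r -> G).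
Context {d d' : measure_display} {X : measurableType d} {Y : measurableType d'}.
Context {mu : probability X R} {nu : probability Y R}.
Variables (T : G -> X -> X) (hT : mp_action mu T).
Variables (S : G -> Y -> Y) (hS : mp_action nu S).
Variables (phi : X -> Y) (mphi : measure_preserving mu nu phi).
Hypothesis equiv : forall g, {ae mu, forall x, phi (T g x) = S g (phi x)}.

(** The pullback commutes with the actions almost everywhere, so it transports
    the joint laws that enter [F]. *)
Lemma F_obs_factor (c : observable nu) :
  F_obs s hT (pullback mphi c) = F_obs s hS c.
Proof.
rewrite /F_obs ent_pullback; congr (_ + _); apply: eq_bigr => i _.
rewrite -(ent_pullback mphi (join c _)).
have cT : {ae mu, forall x, pullback mphi (shift hS (s i) c) x =
    shift hT (s i) (pullback mphi c) x}.
  by apply: filterS (equiv (s i)) => x /= ->.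
have Tc : {ae mu, forall x, shift hT (s i) (pullback mphi c) x =
    pullback mphi (shift hS (s i) c) x}.
  by apply: filterS (equiv (s i)) => x /= ->.
apply: ent_eq.
  apply: (@refines_trans _ _ _ _ _ _ _
    (join (pullback mphi c) (pullback mphi (shift hS (s i) c)))).
    apply: refines_join; first exact: refines_fst.
    exact/(refines_ae Tc)/refines_snd.
  exact: refines_fun.
apply: (@refines_trans _ _ _ _ _ _ _
  (join (pullback mphi c) (pullback mphi (shift hS (s i) c)))).
  exact: refines_fun.
apply: refines_join; first exact: refines_fst.
exact/(refines_ae cT)/refines_snd.
Qed.

End Factor.

Theorem theorem1p7 (R : realType) (r : nat) (G : groupType) (s : 'I_r -> G)
    (hG : free_generators s)
    (d : measure_display) (X : measurableType d) (mu : probability X R)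
    (hX : standard_probability mu)
    (T : G -> X -> X) (hT : mp_action mu T)
    (d' : measure_display) (Y : measurableType d') (nu : probability Y R)
    (hY : standard_probability nu)
    (S : G -> Y -> Y) (hS : mp_action nu S)
    (hfactor : is_factor mu T nu S)
    (hTgen : exists a : set (set X), finite_set a /\ generating mu T a)
    (hSgen : exists b : set (set Y), finite_set b /\ generating nu S b)
    (alpha : set (set X)) (halpha : finite_set alpha)
    (halpha_gen : generating mu T alpha) :
  (f_invariant s mu T - entropy mu alpha <= f_invariant s nu S)%E.
Proof.
have [_ [gamma [fgamma ggamma]]] := (hTgen, hSgen).
have [PT [b [gPT bPT ->]]] := f_invariantP s hT halpha halpha_gen.
have [PS [c [gPS cPS ->]]] := f_invariantP s hS fgamma ggamma.
have malpha : alpha `<=` measurable by case: halpha_gen => -[].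
have [a aalpha] := observable_of_partition halpha_gen.1
  (finite_entropy mu halpha malpha).
rewrite (entropy_ent aalpha).
case: hfactor => phi [mphi equiv].
apply: le_ereal_inf_tmp => _ [n _ <-].
rewrite leeBlDr//; apply/lee_addgt0Pr => e e0.
pose cn := pullback mphi (orbit_join hS c (ball_seq s n)).
have hb := codes_approximable hT gPT bPT.
have ha A (mA : measurable A) : approximable hT (join cn a) A.
  apply: approximable_refines (codes_approximable hT halpha_gen aalpha mA).
  by move=> x y [].
have [N FN] := F_obs_orbit_join_generating hG hb ha e0.
apply: (@le_trans _ _ (F_obs s hT (orbit_join hT b (ball_seq s N)))%:E).
  by apply: ereal_inf_lbound; exists N.
rewrite -!EFinD lee_fin; apply: le_trans FN _; rewrite lerD2r.
apply: le_trans (F_obs_join s hT cn a) _.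
rewrite (F_obs_factor s hT hS mphi equiv) lerD2l.
exact: cond_ent_le_ent.
Qed.
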